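(* Let $F$ be an algebraically closed field (of arbitrary characteristic), and let $X\subseteq\mathbb A^m_F$ be a power hypersurface with an isolated singularity, that is, a hypersurface with an equation of the form $r_1x_1^{a_1}+\dots+r_mx_m^{a_m}=0$ with $a_i>0$ and $r_i\in F$, for which the origin is an isolated singularity. Then the geometric Igusa zeta series $\mathrm{Igu}^{\mathrm{geom}}_X(t)$ is rational over $\mathbf{Gr}(F^{\mathrm{form}})_{\mathbb L}$.
   Context: $\mathcal L_F$ is the first-order language of $F$-algebras. A schemic formula is a finite conjunction of equations $f(x)=0$ with $f\in F[x]$, $x=(x_1,\dots,x_n)$; a pp-formula is $(\exists y)\psi(x,y)$ with $\psi$ schemic; $\mathcal{PP}$ is the Boolean closure of the pp-formulae. $\mathbf{Art}_F$ is the class of Artinian local $F$-algebras (finite-dimensional over $F$). For a set $\Phi$ of formulae of arity $n$ and $R\in\mathbf{Art}_F$, put $\Phi(R):=\bigcup_{\phi\in\Phi}\phi(R)\subseteq R^n$. $\Phi$ is a formulary if for each $R\in\mathbf{Art}_F$ there is $\phi\in\Phi$ with $\phi(R)=\Phi(R)$; formularies are equivalent if they define the same set in all $R\in\mathbf{Art}_F$. $\mathcal{PP}^\infty$ is the lattice (up to equivalence) of formularies consisting of formulae in $\mathcal{PP}$, with $\Phi\wedge\Psi=\{\phi\wedge\psi\}$, $\Phi\vee\Psi=\Phi\cup\Psi$. A schemic isomorphism $\Phi\to\Psi$ is given by a schemic formula $\theta(x,y)$ such that for each $R\in\mathbf{Art}_F$, $\theta(R)$ restricted to $\Phi(R)$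 is the graph of a bijection $\Phi(R)\to\Psi(R)$, the inverses also being given by a schemic formula. $\mathbf{Gr}^\infty(F^{\mathrm{pp}})$ is the free Abelian group on $\mathcal{PP}^\infty$ modulo all $\langle\Phi\rangle-\langle\Psi\rangle$ with $\Phi,\Psi$ schemically isomorphic and all $\langle\Phi\vee\Psi\rangle+\langle\Phi\wedge\Psi\rangle-\langle\Phi\rangle-\langle\Psi\rangle$, a commutative ring with product induced by $\Phi\times\Psi=\{\phi(x)\wedge\psi(y)\}$ ($x,y$ disjoint). The class of an affine $F$-scheme of finite type is the class of a schemic formula defining it. For a closed immersion $Y\subseteq V$ of affine $F$-schemes, $V=\operatorname{Spec}B\subseteq\mathbb A^n_F$, with $Y$ defined by the ideal $I\subseteq B$, the total jet $J_YV$ is the formulary of all schemic formulae defining $\operatorname{Spec}(B/I^k)\subseteq\mathbb A^n_F$, $k\ge1$. The formal Grothendieck ring $\mathbf{Gr}(F^{\mathrm{form}})$ is the quotient of $\mathbf{Gr}^\infty(F^{\mathrm{pp}})$ by the ideal generated by all $[J_YV]-[Y]$. $\mathbb L$ is the class of the affine line and $\mathbf{Gr}(F^{\mathrm{form}})_{\mathbb L}$ is the localization inverting $\mathbb L$. For $X=\operatorname{Spec}F[x]/(f_1,\dots,f_s)$, the linear arc scheme $\nabla_nX$ is the affine scheme in the variables $\tilde x_0,\dots,\tilde x_{n-1}$ (each a tuple like $x$) whose equations express $f_j(\tilde x_0+\tilde x_1\xi+\dots+\tilde x_{n-1}\xi^{n-1})\equiv0\bmod\xi^n$ for all $j$. Then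 $\mathrm{Igu}^{\mathrm{geom}}_X(t):=\sum_n[\nabla_nX]\,t^n$, a power series over $\mathbf{Gr}(F^{\mathrm{form}})$. A power series is rational over a ring $C$ if (its image in $C[[t]]$) equals $p/q$ with $p,q\in C[t]$ and $q$ invertible in $C[[t]]$. *)

(* Defs.v *)
From HB Require Import structures.
From mathcomp Require Import all_boot all_order all_algebra.
From mathcomp Require Import generic_quotient ring_quotient.
From mathcomp Require Import boolp zify ring.
From mathcomp.multinomials Require Import mpoly freeg.

Set Implicit Arguments.
Unset Strict Implicit.
Unset Printing Implicit Defensive.

Import GRing.Theory.

Local Open Scope ring_scope.
Local Open Scope quotient_scope.

(* Nothing below needs 1 != 0, and the rings constructed here are not proved
   to be nonzero: hence comPzRingType throughout. *)

Section GeneratedSubgroup.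
Variables (V : zmodType) (S : V -> Prop).

Inductive subgroup_gen : V -> Prop :=
| subgroup_gen_in x of S x : subgroup_gen x
| subgroup_gen0 : subgroup_gen 0
| subgroup_genB x y of subgroup_gen x & subgroup_gen y : subgroup_gen (x - y).

Definition subgroup_pred : {pred V} := fun x => `[< subgroup_gen x >].

Lemma subgroup_pred_closed : zmod_closed subgroup_pred.
Proof.
split=> [|x y /asboolP xS /asboolP yS]; apply/asboolP.
  exact: subgroup_gen0.
exact: subgroup_genB.
Qed.

HB.instance Definition _ :=
  GRing.isZmodClosed.Build V subgroup_pred subgroup_pred_closed.
End GeneratedSubgroup.

Section GeneratedIdeal.
Variables (R : comPzRingType) (S : R -> Prop).

Inductive ideal_gen : R -> Prop :=
| ideal_gen_in x of S x : ideal_gen x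
| ideal_gen0 : ideal_gen 0
| ideal_genD x y of ideal_gen x & ideal_gen y : ideal_gen (x + y)
| ideal_genM a x of ideal_gen x : ideal_gen (a * x).

Definition ideal_pred : {pred R} := fun x => `[< ideal_gen x >].

Lemma ideal_pred_closed : zmod_closed ideal_pred.
Proof.
split=> [|x y /asboolP xS /asboolP yS]; apply/asboolP.
  exact: ideal_gen0.
by rewrite -[y]mul1r -mulNr; apply/ideal_genD/ideal_genM.
Qed.

HB.instance Definition _ :=
  GRing.isZmodClosed.Build R ideal_pred ideal_pred_closed.

Definition ideal_quotient := @Quotient.quot R ideal_pred.

HB.instance Definition _ := GRing.Zmodule.on ideal_quotient.

Definition ideal_proj (x : R) : ideal_quotient := \pi_(@Quotient.quot R ideal_pred) x.

Lemma ideal_projP x y : ideal_proj x = ideal_proj y <-> ideal_gen (x - y).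
Proof.
rewrite /ideal_proj; split=> [/eqP|xy].
  by rewrite -Quotient.idealrBE => /asboolP.
by apply/eqP; rewrite -Quotient.idealrBE; apply/asboolP.
Qed.

Definition ideal_quotient_mul (x y : ideal_quotient) : ideal_quotient :=
  ideal_proj (repr x * repr y).

Let projK x : ideal_proj (repr x) = x.
Proof. exact: reprK. Qed.

Let projB x : ideal_gen (repr (ideal_proj x) - x).
Proof. by apply/ideal_projP; rewrite projK. Qed.

Let projM x y :
  ideal_quotient_mul (ideal_proj x) (ideal_proj y) = ideal_proj (x * y).
Proof.
apply/ideal_projP; set x' := repr _; set y' := repr _.
have -> : x' * y' - x * y = y' * (x' - x) + x * (y' - y).
  by rewrite !mulrBr mulrC [x * y']mulrC addrA subrK.
by apply: ideal_genD; apply: ideal_genM; apply: projB.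
Qed.

Let projD x y : ideal_proj (x + y) = ideal_proj x + ideal_proj y.
Proof. by rewrite /ideal_proj !piE. Qed.

Let quotP (P : ideal_quotient -> Prop) : (forall x, P (ideal_proj x)) -> forall x, P x.
Proof. by move=> H x; rewrite -[x]projK. Qed.

Let mulA : associative ideal_quotient_mul.
Proof. by do 3 elim/quotP=> ?; rewrite !projM mulrA. Qed.

Let mulC : commutative ideal_quotient_mul.
Proof. by do 2 elim/quotP=> ?; rewrite !projM mulrC. Qed.

Let mul1 : left_id (ideal_proj 1) ideal_quotient_mul.
Proof. by elim/quotP=> ?; rewrite !projM mul1r. Qed.

Let mulD : left_distributive ideal_quotient_mul +%R.
Proof. by do 3 elim/quotP=> ?; rewrite -projD !projM mulrDl projD. Qed.

HB.instance Definition _ :=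
  GRing.Zmodule_isComPzRing.Build ideal_quotient mulA mulC mul1 mulD.

Lemma ideal_proj_is_zmod_morphism : zmod_morphism ideal_proj.
Proof. by move=> x y; rewrite /ideal_proj !piE. Qed.

Lemma ideal_proj_is_monoid_morphism : monoid_morphism ideal_proj.
Proof. by split=> // x y; rewrite -projM. Qed.

HB.instance Definition _ :=
  GRing.isZmodMorphism.Build R ideal_quotient ideal_proj
    ideal_proj_is_zmod_morphism.
HB.instance Definition _ :=
  GRing.isMonoidMorphism.Build R ideal_quotient ideal_proj
    ideal_proj_is_monoid_morphism.
End GeneratedIdeal.

(* Fractions a / s^k, with (a, k) ~ (b, l) iff s^j (s^l a - s^k b) = 0 for
   some j. *)
Section Localization.
Variables (R : comPzRingType) (s : R).
Implicit Types u v w : R * nat.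

Definition loc_rel u v : bool :=
  `[< exists j, s ^+ j * (s ^+ v.2 * u.1 - s ^+ u.2 * v.1) = 0 >].

Lemma loc_relP u v :
  reflect (exists j, s ^+ (j + v.2) * u.1 = s ^+ (j + u.2) * v.1) (loc_rel u v).
Proof.
apply: (iffP (asboolP _)) => -[j e]; exists j; move: e.
  by rewrite mulrBr !mulrA -!exprD => /eqP; rewrite subr_eq0 => /eqP.
by rewrite mulrBr !mulrA -!exprD => ->; rewrite subrr.
Qed.

Lemma loc_rel_equiv : equiv_class_of loc_rel.
Proof.
have sym u v : loc_rel u v -> loc_rel v u.
  by case/loc_relP=> j e; apply/loc_relP; exists j.
split=> [u|u v|v u w].
- by apply/loc_relP; exists 0%N.
- by apply/idP/idP; apply: sym.
case/loc_relP=> i e /loc_relP[j e']; apply/loc_relP; exists (i + j + v.2)%N.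
have -> : (i + j + v.2 + w.2 = (j + w.2) + (i + v.2))%N by lia.
rewrite exprD -mulrA e mulrCA e' mulrA -exprD; congr (_ ^+ _ * _); lia.
Qed.

Canonical loc_equiv := EquivRelPack loc_rel_equiv.
Canonical loc_encModRel := defaultEncModRel loc_rel.

Definition localization := {eq_quot loc_rel}.

HB.instance Definition _ := Choice.on localization.

Definition loc_frac u : localization := \pi_{eq_quot loc_rel} u.

Lemma loc_fracP u v : loc_frac u = loc_frac v <->
  exists j, s ^+ (j + v.2) * u.1 = s ^+ (j + u.2) * v.1.
Proof.
split=> [/eqmodP/loc_relP //|uv]; apply/eqmodP; exact/loc_relP.
Qed.

Definition loc_add (x y : localization) : localization :=
  let u := repr x in let v := repr y in
  loc_frac (s ^+ v.2 * u.1 + s ^+ u.2 * v.1, (u.2 + v.2)%N).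
Definition loc_opp (x : localization) : localization :=
  loc_frac (- (repr x).1, (repr x).2).
Definition loc_mul (x y : localization) : localization :=
  loc_frac ((repr x).1 * (repr y).1, ((repr x).2 + (repr y).2)%N).

Let fracK x : loc_frac (repr x) = x.
Proof. exact: reprK. Qed.

Let reprP u : exists j, s ^+ (j + u.2) * (repr (loc_frac u)).1 =
                        s ^+ (j + (repr (loc_frac u)).2) * u.1.
Proof. by apply/loc_fracP; rewrite fracK. Qed.

Let fracD u v : loc_add (loc_frac u) (loc_frac v) =
  loc_frac (s ^+ v.2 * u.1 + s ^+ u.2 * v.1, (u.2 + v.2)%N).
Proof.
have [[i ei] [j ej]] := (reprP u, reprP v); rewrite /loc_add.
apply/loc_fracP; exists (i + j)%N; move: ei ej.
move: u v (repr (loc_frac u)) (repr (loc_frac v)) => [a k] [b l] [a' k'] [b' l'] /=.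
rewrite !exprD.
move: (s ^+ i) (s ^+ j) (s ^+ k) (s ^+ l) (s ^+ k') (s ^+ l').
move=> {}i {}j {}k {}l {}k' {}l' ei ej; rewrite !mulrDr; congr (_ + _).
  by transitivity (j * l * l' * (i * k * a')); [|rewrite ei]; ring.
by transitivity (i * k * k' * (j * l * b')); [|rewrite ej]; ring.
Qed.

Let fracN u : loc_opp (loc_frac u) = loc_frac (- u.1, u.2).
Proof.
have [i ei] := reprP u; apply/loc_fracP; exists i => /=.
by rewrite !mulrN ei.
Qed.

Let fracM u v : loc_mul (loc_frac u) (loc_frac v) =
  loc_frac (u.1 * v.1, (u.2 + v.2)%N).
Proof.
have [[i ei] [j ej]] := (reprP u, reprP v); rewrite /loc_mul.
apply/loc_fracP; exists (i + j)%N; move: ei ej.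
move: u v (repr (loc_frac u)) (repr (loc_frac v)) => [a k] [b l] [a' k'] [b' l'] /=.
rewrite !exprD.
move: (s ^+ i) (s ^+ j) (s ^+ k) (s ^+ l) (s ^+ k') (s ^+ l').
move=> {}i {}j {}k {}l {}k' {}l' ei ej.
by transitivity ((i * k * a') * (j * l * b')); [|rewrite ei ej]; ring.
Qed.

Let locP (P : localization -> Prop) : (forall u, P (loc_frac u)) -> forall x, P x.
Proof. by move=> H x; rewrite -[x]fracK. Qed.

Let frac_eq u v : s ^+ v.2 * u.1 = s ^+ u.2 * v.1 -> loc_frac u = loc_frac v.
Proof. by move=> e; apply/loc_fracP; exists 0%N. Qed.

Let addA : associative loc_add.
Proof.
elim/locP=> -[a k]; elim/locP=> -[b l]; elim/locP=> -[c m].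
rewrite !fracD; apply: frac_eq; rewrite /= !exprD.
by move: (s ^+ k) (s ^+ l) (s ^+ m) => K L M; ring.
Qed.

Let addC : commutative loc_add.
Proof.
elim/locP=> -[a k]; elim/locP=> -[b l].
by rewrite !fracD; apply: frac_eq; rewrite /= ?exprD ?expr0; ring.
Qed.

Let add0 : left_id (loc_frac (0, 0%N)) loc_add.
Proof.
elim/locP=> -[a k].
by rewrite !fracD; apply: frac_eq; rewrite /= ?exprD ?expr0; ring.
Qed.

Let addN : left_inverse (loc_frac (0, 0%N)) loc_opp loc_add.
Proof.
elim/locP=> -[a k].
by rewrite fracN fracD; apply: frac_eq; rewrite /= ?exprD ?expr0; ring.
Qed.

HB.instance Definition _ :=
  GRing.isZmodule.Build localization addA addC add0 addN.

Let fracDE u v : loc_frac u + loc_frac v =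
  loc_frac (s ^+ v.2 * u.1 + s ^+ u.2 * v.1, (u.2 + v.2)%N).
Proof. exact: fracD. Qed.

Let mulA : associative loc_mul.
Proof.
elim/locP=> -[a k]; elim/locP=> -[b l]; elim/locP=> -[c m].
by rewrite !fracM; apply: frac_eq; rewrite /= ?exprD ?expr0; ring.
Qed.

Let mulC : commutative loc_mul.
Proof.
elim/locP=> -[a k]; elim/locP=> -[b l].
by rewrite !fracM; apply: frac_eq; rewrite /= ?exprD ?expr0; ring.
Qed.

Let mul1 : left_id (loc_frac (1, 0%N)) loc_mul.
Proof.
elim/locP=> -[a k].
by rewrite !fracM; apply: frac_eq; rewrite /= ?exprD ?expr0; ring.
Qed.

Let mulD : left_distributive loc_mul +%R.
Proof.
elim/locP=> -[a k]; elim/locP=> -[b l]; elim/locP=> -[c m].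
rewrite fracDE !fracM fracDE; apply: frac_eq; rewrite /= !exprD.
by move: (s ^+ k) (s ^+ l) (s ^+ m) => K L M; ring.
Qed.

HB.instance Definition _ :=
  GRing.Zmodule_isComPzRing.Build localization mulA mulC mul1 mulD.

Definition loc_map (a : R) : localization := loc_frac (a, 0%N).

Lemma loc_map_is_zmod_morphism : zmod_morphism loc_map.
Proof.
move=> x y; rewrite /loc_map -[RHS]/(loc_add _ (loc_opp _)) fracN fracD.
by apply: frac_eq; rewrite /= ?exprD ?expr0; ring.
Qed.

Lemma loc_map_is_monoid_morphism : monoid_morphism loc_map.
Proof.
split=> // x y; rewrite /loc_map -[RHS]/(loc_mul _ _) fracM.
by apply: frac_eq; rewrite /= ?exprD ?expr0; ring.
Qed.

HB.instance Definition _ :=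
  GRing.isZmodMorphism.Build R localization loc_map loc_map_is_zmod_morphism.
HB.instance Definition _ :=
  GRing.isMonoidMorphism.Build R localization loc_map
    loc_map_is_monoid_morphism.

Lemma loc_map_inv : loc_map s * loc_frac (1, 1%N) = 1.
Proof.
rewrite -[LHS]/(loc_mul _ _) fracM -[RHS]/(loc_frac (1, 0%N)).
by apply: frac_eq => /=; ring.
Qed.
End Localization.

(* {poly C} is not available over a comPzRingType, so a polynomial is a power
   series with finitely many nonzero coefficients. *)
Section PowerSeries.
Variable C : comPzRingType.

Definition power_series := nat -> C.
Implicit Types f g p q : power_series.

Definition ps_mul f g : power_series :=
  fun n => \sum_(i < n.+1) f i * g (n - i)%N.
Definition ps_one : power_series := fun n => (n == 0)%:R.
Definition ps_polynomial p := exists d, forall n, (d <= n)%N -> p n = 0.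

(* f = p / q with q' the inverse of q *)
Definition ps_rational f := exists p q q',
  [/\ ps_polynomial p, ps_polynomial q, ps_mul q q' =1 ps_one
    & f =1 ps_mul p q'].
End PowerSeries.

Section Formulae.
Variable F : fieldType.

Definition finite_dimensional (R : lmodType F) : Prop :=
  exists s : seq R, forall x : R,
    exists c : nat -> F, x = \sum_(i < size s) c i *: s`_i.

Definition local_ring (R : unitRingType) : Prop :=
  forall x y : R, x \isn't a GRing.unit -> y \isn't a GRing.unit ->
    x + y \isn't a GRing.unit.

(* The objects of Art_F; the underlying ring is nonzero by the choice of
   comUnitAlgType, and it is Artinian because it is finite-dimensional. *)
Record artinian_local_algebra := ArtinianLocalAlgebra {
  art_sort :> comUnitAlgType F;
  art_finite_dimensional : finite_dimensional art_sort;
  art_local : local_ring art_sort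
}.

Definition value (R : comUnitAlgType F) n (x : 'rV[R]_n) (f : {mpoly F[n]}) : R :=
  mmap (in_alg R) (x 0) f.

Definition schemic n := seq {mpoly F[n]}.

(* Exists y, psi(x, y), with y a tuple of pp_bound variables which come after
   those of x *)
Record pp_formula n := PPFormula {
  pp_bound : nat;
  pp_matrix : schemic (n + pp_bound)
}.

Inductive formula n : Type :=
| PPAtom of pp_formula n
| Not of formula n
| And of formula n & formula n
| Or of formula n & formula n.

Definition schemic_sat (R : comUnitAlgType F) n (psi : schemic n) (x : 'rV[R]_n)
  : Prop := forall f, f \in psi -> value x f = 0.

Fixpoint sat (R : comUnitAlgType F) n (phi : formula n) (x : 'rV[R]_n) : Prop :=
  match phi with
  | PPAtom psi => exists y, schemic_sat (pp_matrix psi) (row_mx x y)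
  | Not phi => ~ sat phi x
  | And phi psi => sat phi x /\ sat psi x
  | Or phi psi => sat phi x \/ sat psi x
  end.

Definition mpoly_rename n p (s : 'I_n -> 'I_p) (f : {mpoly F[n]}) : {mpoly F[p]} :=
  mmap (@mpolyC p F) (fun i => 'X_(s i)) f.

Definition schemic_rename n p (s : 'I_n -> 'I_p) (psi : schemic n) : schemic p :=
  map (mpoly_rename s) psi.

Definition rename_under n p (s : 'I_n -> 'I_p) k (i : 'I_(n + k)) : 'I_(p + k) :=
  match split i with inl j => lshift k (s j) | inr j => rshift p j end.

Definition pp_rename n p (s : 'I_n -> 'I_p) (psi : pp_formula n) : pp_formula p :=
  PPFormula (schemic_rename (@rename_under n p s (pp_bound psi)) (pp_matrix psi)).

Fixpoint formula_rename n p (s : 'I_n -> 'I_p) (phi : formula n) : formula p :=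
  match phi with
  | PPAtom psi => PPAtom (pp_rename s psi)
  | Not phi => Not (formula_rename s phi)
  | And phi psi => And (formula_rename s phi) (formula_rename s psi)
  | Or phi psi => Or (formula_rename s phi) (formula_rename s psi)
  end.

(* A schemic formula is the pp-formula with an empty tuple of bound variables. *)
Definition schemic_formula n (psi : schemic n) : formula n :=
  PPAtom (@PPFormula n 0 (schemic_rename (lshift 0) psi)).

Lemma value_rename (R : comUnitAlgType F) n p (s : 'I_n -> 'I_p) (x : 'rV[R]_p) f :
  value x (mpoly_rename s f) = value (colsub s x) f.
Proof.
rewrite /value /mpoly_rename [X in mmap _ _ X]/mmap raddf_sum /=.
rewrite [RHS]/mmap; apply: eq_bigr => m _; rewrite rmorphM /= mmapC; congr (_ * _).
rewrite /mmap1 rmorph_prod; apply: eq_bigr => i _.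
by rewrite rmorphXn /= mmapX mmap1U mxE.
Qed.

Lemma schemic_sat_rename (R : comUnitAlgType F) n p (s : 'I_n -> 'I_p)
    (psi : schemic n) (x : 'rV[R]_p) :
  schemic_sat (schemic_rename s psi) x <-> schemic_sat psi (colsub s x).
Proof.
split=> [H f fpsi | H _ /mapP[f fpsi ->]].
  by rewrite -value_rename; apply: H; apply: map_f.
by rewrite value_rename; apply: H.
Qed.

Lemma colsub_rename_under (R : comUnitAlgType F) n p (s : 'I_n -> 'I_p) k
    (x : 'rV[R]_p) (y : 'rV[R]_k) :
  colsub (@rename_under n p s k) (row_mx x y) = row_mx (colsub s x) y.
Proof.
apply/rowP=> i; rewrite mxE /rename_under; case: (splitP i) => j ij.
  rewrite (_ : i = lshift k j); last exact: val_inj.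
  by rewrite !row_mxEl mxE.
rewrite (_ : i = rshift n j); last exact: val_inj.
by rewrite !row_mxEr.
Qed.

Lemma sat_rename (R : comUnitAlgType F) n p (s : 'I_n -> 'I_p)
    (phi : formula n) (x : 'rV[R]_p) :
  sat (formula_rename s phi) x <-> sat phi (colsub s x).
Proof.
elim: phi => [psi|phi IH|phi IH1 psi IH2|phi IH1 psi IH2] /=; last 3 first.
- by split=> H /IH.
- by split=> -[/IH1 ? /IH2 ?].
- by split=> -[/IH1|/IH2]; [left|right|left|right].
by split=> -[y Hy]; exists y; move: Hy;
   rewrite -colsub_rename_under => /schemic_sat_rename.
Qed.

Lemma sat_schemic (R : comUnitAlgType F) n (psi : schemic n) (x : 'rV[R]_n) :
  sat (schemic_formula psi) x <-> schemic_sat psi x.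
Proof.
have E (y : 'rV[R]_0) : colsub (lshift 0) (row_mx x y) = x.
  by apply/rowP=> i; rewrite mxE row_mxEl.
split=> /= [[y /schemic_sat_rename]|H]; first by rewrite E.
by exists 0; apply/schemic_sat_rename; rewrite E.
Qed.

Definition defset n (Phi : formula n -> Prop) (R : comUnitAlgType F)
    (x : 'rV[R]_n) : Prop :=
  exists phi, Phi phi /\ sat phi x.

Record formulary n := Formulary {
  formulae :> formula n -> Prop;
  formularyP : forall R : artinian_local_algebra, exists phi, formulae phi /\
    forall x : 'rV[R]_n, sat phi x <-> defset formulae x
}.

Lemma formulary1_subproof n (phi : formula n) (R : artinian_local_algebra) :
  exists psi, psi = phi /\
    forall x : 'rV[R]_n, sat psi x <-> defset (fun psi => psi = phi) x.
Proof.
exists phi; split=> // x; split=> [H|[_ [-> //]]]; by exists phi.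
Qed.

Definition formulary1 n (phi : formula n) : formulary n :=
  @Formulary n (fun psi => psi = phi) (formulary1_subproof phi).

Lemma defset1 n (phi : formula n) (R : comUnitAlgType F) (x : 'rV[R]_n) :
  defset (formulary1 phi) x <-> sat phi x.
Proof. by split=> [[_ [-> //]]|H]; exists phi. Qed.

Section BinaryOperations.
Variables (n m p : nat) (op : formula n -> formula m -> formula p).

Definition image_op (Phi : formula n -> Prop) (Psi : formula m -> Prop) chi :=
  exists phi psi, [/\ Phi phi, Psi psi & chi = op phi psi].
End BinaryOperations.

Lemma meet_subproof n (Phi Psi : formulary n) (R : artinian_local_algebra) :
  exists chi, image_op (@And n) Phi Psi chi /\
    forall x : 'rV[R]_n, sat chi x <-> defset (image_op (@And n) Phi Psi) x.
Proof.
have [[phi [Pphi Ephi]] [psi [Ppsi Epsi]]] := (formularyP Phi R, formularyP Psi R).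
exists (And phi psi); split; first by exists phi, psi.
move=> x; split=> [H|[_ [[phi' [psi' [P1 P2 ->]]] /= [S1 S2]]]].
  by exists (And phi psi); split=> //; exists phi, psi.
by split; [apply/Ephi; exists phi'|apply/Epsi; exists psi'].
Qed.

Definition formulary_meet n (Phi Psi : formulary n) : formulary n :=
  Formulary (meet_subproof Phi Psi).

(* The union of the two sets of formulae defines the right subset of each R^n,
   but that subset need not be defined by a single one of the formulae; the
   formulae phi \/ psi define the same subsets and do form a formulary. *)
Lemma join_subproof n (Phi Psi : formulary n) (R : artinian_local_algebra) :
  exists chi, image_op (@Or n) Phi Psi chi /\
    forall x : 'rV[R]_n, sat chi x <-> defset (image_op (@Or n) Phi Psi) x.
Proof.
have [[phi [Pphi Ephi]] [psi [Ppsi Epsi]]] := (formularyP Phi R, formularyP Psi R).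
exists (Or phi psi); split; first by exists phi, psi.
move=> x; split=> [H|[_ [[phi' [psi' [P1 P2 ->]]] /= [S1|S2]]]].
- by exists (Or phi psi); split=> //; exists phi, psi.
- by left; apply/Ephi; exists phi'.
- by right; apply/Epsi; exists psi'.
Qed.

Definition formulary_join n (Phi Psi : formulary n) : formulary n :=
  Formulary (join_subproof Phi Psi).

Definition formula_prod n m (phi : formula n) (psi : formula m) : formula (n + m) :=
  And (formula_rename (lshift m) phi) (formula_rename (@rshift n m) psi).

Lemma colsub_lshift (R : comUnitAlgType F) n m (x : 'rV[R]_(n + m)) :
  colsub (lshift m) x = lsubmx x.
Proof. by apply/rowP=> i; rewrite !mxE. Qed.

Lemma colsub_rshift (R : comUnitAlgType F) n m (x : 'rV[R]_(n + m)) :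
  colsub (@rshift n m) x = rsubmx x.
Proof. by apply/rowP=> i; rewrite !mxE. Qed.

Lemma sat_prod (R : comUnitAlgType F) n m (phi : formula n) (psi : formula m)
    (x : 'rV[R]_(n + m)) :
  sat (formula_prod phi psi) x <-> sat phi (lsubmx x) /\ sat psi (rsubmx x).
Proof.
by rewrite -colsub_lshift -colsub_rshift /=; split=> -[/sat_rename ? /sat_rename ?].
Qed.

Lemma prod_subproof n m (Phi : formulary n) (Psi : formulary m)
    (R : artinian_local_algebra) :
  exists chi, image_op (@formula_prod n m) Phi Psi chi /\
    forall x : 'rV[R]_(n + m),
      sat chi x <-> defset (image_op (@formula_prod n m) Phi Psi) x.
Proof.
have [[phi [Pphi Ephi]] [psi [Ppsi Epsi]]] := (formularyP Phi R, formularyP Psi R).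
exists (formula_prod phi psi); split; first by exists phi, psi.
move=> x; split=> [H|[_ [[phi' [psi' [P1 P2 ->]]] /sat_prod [S1 S2]]]].
  by exists (formula_prod phi psi); split=> //; exists phi, psi.
by apply/sat_prod; split; [apply/Ephi; exists phi'|apply/Epsi; exists psi'].
Qed.

Definition formulary_prod n m (Phi : formulary n) (Psi : formulary m)
  : formulary (n + m) := Formulary (prod_subproof Phi Psi).

Lemma defset_meet n (Phi Psi : formulary n) (R : comUnitAlgType F) (x : 'rV[R]_n) :
  defset (formulary_meet Phi Psi) x <-> defset Phi x /\ defset Psi x.
Proof.
split=> [[_ [[phi [psi [? ? ->]]] /= [? ?]]]|[[phi [? ?]] [psi [? ?]]]].
  by split; [exists phi|exists psi].
by exists (And phi psi); split=> //; exists phi, psi.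
Qed.

Lemma defset_join n (Phi Psi : formulary n) (R : artinian_local_algebra) (x : 'rV[R]_n) :
  defset (formulary_join Phi Psi) x <-> defset Phi x \/ defset Psi x.
Proof.
have [[phi [Pphi Ephi]] [psi [Ppsi Epsi]]] := (formularyP Phi R, formularyP Psi R).
split=> [[_ [[phi' [psi' [? ? ->]]] /= [S|S]]]|H].
- by left; exists phi'.
- by right; exists psi'.
exists (Or phi psi); split; first by exists phi, psi.
by case: H => [/Ephi|/Epsi]; [left|right].
Qed.

Lemma defset_prod n m (Phi : formulary n) (Psi : formulary m)
    (R : comUnitAlgType F) (x : 'rV[R]_(n + m)) :
  defset (formulary_prod Phi Psi) x <->
  defset Phi (lsubmx x) /\ defset Psi (rsubmx x).
Proof.
split=> [[_ [[phi [psi [? ? ->]]] /sat_prod [? ?]]]|[[phi [? ?]] [psi [? ?]]]].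
  by split; [exists phi|exists psi].
by exists (formula_prod phi psi); split; [exists phi, psi|apply/sat_prod].
Qed.

Record any_formulary := AnyFormulary {
  arity : nat;
  any_formulary_val : formulary arity
}.

HB.instance Definition _ := gen_eqMixin any_formulary.
HB.instance Definition _ := gen_choiceMixin any_formulary.

Definition formulary_equiv (Phi Psi : any_formulary) : Prop :=
  exists e : arity Phi = arity Psi,
    forall (R : artinian_local_algebra) (x : 'rV[R]_(arity Phi)),
      defset (any_formulary_val Phi) x <->
      defset (any_formulary_val Psi) (castmx (erefl, e) x).

Lemma formulary_equiv_intro n (Phi Psi : formulary n) :
  (forall (R : artinian_local_algebra) (x : 'rV[R]_n),
     defset Phi x <-> defset Psi x) ->
  formulary_equiv (AnyFormulary Phi) (AnyFormulary Psi).
Proof. by move=> H; exists (erefl n) => R x; rewrite castmx_id. Qed.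

Definition formulary_rel Phi Psi : bool := `[< formulary_equiv Phi Psi >].

Lemma formulary_rel_equiv : equiv_class_of formulary_rel.
Proof.
have sym Phi Psi : formulary_equiv Phi Psi -> formulary_equiv Psi Phi.
  case: Phi Psi => n Phi [m Psi] [/= e]; case: m / e Psi => Psi H.
  by apply: formulary_equiv_intro => R x; rewrite H castmx_id.
split=> [[n Phi]|Phi Psi|Psi Phi Omega].
- by apply/asboolP/formulary_equiv_intro.
- by apply/asboolP/asboolP; apply: sym.
case: Phi Psi Omega => n Phi [m Psi] [p Omega] /asboolP[/= e]; case: m / e Psi => Psi H.
case/asboolP=> /= e; case: p / e Omega => Omega H'; apply/asboolP.
by apply: formulary_equiv_intro => R x; rewrite H H' !castmx_id.
Qed.

Canonical formulary_equivRel := EquivRelPack formulary_rel_equiv.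
Canonical formulary_encModRel := defaultEncModRel formulary_rel.

Definition PPoo := {eq_quot formulary_rel}.

HB.instance Definition _ := Choice.on PPoo.

Definition PPoo_class n (Phi : formulary n) : PPoo :=
  \pi_{eq_quot formulary_rel} (AnyFormulary Phi).

Lemma PPoo_classP n (Phi Psi : formulary n) :
  (forall (R : artinian_local_algebra) (x : 'rV[R]_n),
     defset Phi x <-> defset Psi x) ->
  PPoo_class Phi = PPoo_class Psi.
Proof. by move=> H; rewrite /PPoo_class; apply/eqmodP/asboolP/formulary_equiv_intro. Qed.

Lemma PPoo_ind (P : PPoo -> Prop) :
  (forall n (Phi : formulary n), P (PPoo_class Phi)) -> forall u, P u.
Proof.
by move=> H u; rewrite -[u]reprK; case: (repr u) => n Phi; apply: H.
Qed.

Definition PPoo_prod (u v : PPoo) : PPoo :=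
  PPoo_class (formulary_prod (any_formulary_val (repr u)) (any_formulary_val (repr v))).

Lemma PPoo_prod_class n m (Phi : formulary n) (Psi : formulary m) :
  PPoo_prod (PPoo_class Phi) (PPoo_class Psi) =
  PPoo_class (formulary_prod Phi Psi).
Proof.
have E k (Omega : formulary k) : formulary_equiv (repr (PPoo_class Omega)) (AnyFormulary Omega).
  apply/asboolP; rewrite -/(formulary_rel _ _); apply/eqmodP; exact: reprK.
rewrite /PPoo_prod; move: (E _ Phi) (E _ Psi).
case: (repr _) => n' Phi' [/= e H]; case: (repr _) => m' Psi' [/= e' H'].
case: n / e Phi H {E} => Phi H; case: m / e' Psi H' => Psi H'.
apply: PPoo_classP => R x; split=> /defset_prod[]; rewrite ?(H, H') => H1 H2;
  apply/defset_prod; rewrite ?(H, H'); split; move: H1 H2; by rewrite ?castmx_id.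
Qed.

(* theta, restricted to Phi(R), is the graph of a bijection from Phi(R) to
   Psi(R), and theta' is likewise the graph of its inverse. *)
Definition schemic_iso n m (Phi : formulary n) (Psi : formulary m) : Prop :=
  exists (theta : schemic (n + m)) (theta' : schemic (m + n)),
  forall R : artinian_local_algebra,
  exists (f : 'rV[R]_n -> 'rV[R]_m) (g : 'rV[R]_m -> 'rV[R]_n),
  [/\ forall x, defset Phi x -> defset Psi (f x) /\ g (f x) = x,
      forall y, defset Psi y -> defset Phi (g y) /\ f (g y) = y,
      forall x y, defset Phi x ->
        (schemic_sat theta (row_mx x y) <-> y = f x)
    & forall y x, defset Psi y ->
        (schemic_sat theta' (row_mx y x) <-> x = g y)].

Definition coord_eqs n m (s : 'I_m -> 'I_n) : schemic (n + m) :=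
  [seq 'X_(rshift n j) - 'X_(lshift m (s j)) | j <- enum 'I_m].

Lemma valueD (R : comUnitAlgType F) n (x : 'rV[R]_n) f g :
  value x (f + g) = value x f + value x g.
Proof. exact: raddfD. Qed.

Lemma valueB (R : comUnitAlgType F) n (x : 'rV[R]_n) f g :
  value x (f - g) = value x f - value x g.
Proof. exact: raddfB. Qed.

Lemma valueM (R : comUnitAlgType F) n (x : 'rV[R]_n) f g :
  value x (f * g) = value x f * value x g.
Proof. exact: rmorphM. Qed.

Lemma valueX (R : comUnitAlgType F) n (x : 'rV[R]_n) i : value x 'X_i = x 0 i.
Proof. by rewrite /value mmapX mmap1U. Qed.

Lemma coord_eqsP (R : comUnitAlgType F) n m (s : 'I_m -> 'I_n)
    (x : 'rV[R]_n) (y : 'rV[R]_m) :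
  schemic_sat (coord_eqs s) (row_mx x y) <-> y = colsub s x.
Proof.
split=> [H|-> _ /mapP[j _ ->]].
  apply/rowP=> j; apply/eqP; rewrite mxE -subr_eq0.
  have := H _ (map_f _ (mem_enum 'I_m j)).
  by rewrite valueB !valueX row_mxEr row_mxEl => ->.
by rewrite valueB !valueX row_mxEr row_mxEl mxE subrr.
Qed.

Lemma schemic_iso_perm n m (Phi : formulary n) (Psi : formulary m)
    (s : 'I_m -> 'I_n) (t : 'I_n -> 'I_m) :
  cancel s t -> cancel t s ->
  (forall (R : artinian_local_algebra) (x : 'rV[R]_n),
     defset Phi x <-> defset Psi (colsub s x)) ->
  schemic_iso Phi Psi.
Proof.
move=> sK tK H; exists (coord_eqs s), (coord_eqs t) => R.
have st (x : 'rV[R]_n) : colsub t (colsub s x) = x.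
  by apply/rowP=> i; rewrite !mxE tK.
have ts (y : 'rV[R]_m) : colsub s (colsub t y) = y.
  by apply/rowP=> i; rewrite !mxE sK.
exists (colsub s), (colsub t); split=> [x /H //|y Hy|x y _|y x _].
- by split=> //; apply/H; rewrite ts.
- exact: coord_eqsP.
- exact: coord_eqsP.
Qed.

Definition prod_graph n m k (theta : schemic (n + m)) :
    schemic ((n + k) + (m + k)) :=
  schemic_rename
    (fun i => match split i with
              | inl i => lshift (m + k) (lshift k i)
              | inr i => rshift (n + k) (lshift k i)
              end) theta
  ++ [seq 'X_(rshift (n + k) (rshift m j)) - 'X_(lshift (m + k) (rshift n j))
     | j <- enum 'I_k].

Lemma prod_graphP (R : comUnitAlgType F) n m k (theta : schemic (n + m))
    (x : 'rV[R]_(n + k)) (y : 'rV[R]_(m + k)) :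
  schemic_sat (prod_graph k theta) (row_mx x y) <->
  schemic_sat theta (row_mx (lsubmx x) (lsubmx y)) /\ rsubmx y = rsubmx x.
Proof.
rewrite /prod_graph; set s := (X in schemic_rename X _).
have E : colsub s (row_mx x y) = row_mx (lsubmx x) (lsubmx y).
  apply/rowP=> i; rewrite mxE /s; case: (splitP i) => j ij.
    rewrite (_ : i = lshift m j); last exact: val_inj.
    by rewrite !row_mxEl !mxE.
  rewrite (_ : i = rshift n j); last exact: val_inj.
  by rewrite !row_mxEr !mxE.
split=> [H|[H1 H2] f].
  split; first by rewrite -E; apply/schemic_sat_rename => f Hf;
    apply: H; rewrite mem_cat Hf.
  apply/rowP=> j; apply/eqP; rewrite !mxE -subr_eq0.
  have := H ('X_(rshift (n + k) (rshift m j)) - 'X_(lshift (m + k) (rshift n j))).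
  rewrite valueB !valueX row_mxEr row_mxEl => ->//.
  by rewrite mem_cat; apply/orP; right; apply: map_f; rewrite mem_enum.
rewrite mem_cat => /orP[Hf|/mapP[j _ ->]].
  by move: f Hf; apply/schemic_sat_rename; rewrite E.
have /rowP/(_ j) := H2; rewrite !mxE => H.
by rewrite valueB !valueX row_mxEr row_mxEl H subrr.
Qed.

Lemma schemic_iso_prodr n m k (Phi : formulary n) (Psi : formulary m)
    (Omega : formulary k) : schemic_iso Phi Psi ->
  schemic_iso (formulary_prod Phi Omega) (formulary_prod Psi Omega).
Proof.
move=> [theta [theta' iso]]; exists (prod_graph k theta), (prod_graph k theta').
move=> R; have [f [g [Hf Hg Ht Ht']]] := iso R.
exists (fun x => row_mx (f (lsubmx x)) (rsubmx x)).
exists (fun y => row_mx (g (lsubmx y)) (rsubmx y)).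
split=> [x /defset_prod[Hx Hx']|y /defset_prod[Hy Hy']|x y /defset_prod[Hx Hx']
        |y x /defset_prod[Hy Hy']].
- have [H1 H2] := Hf _ Hx; rewrite row_mxKl row_mxKr H2 hsubmxK; split=> //.
  by apply/defset_prod; rewrite row_mxKl row_mxKr.
- have [H1 H2] := Hg _ Hy; rewrite row_mxKl row_mxKr H2 hsubmxK; split=> //.
  by apply/defset_prod; rewrite row_mxKl row_mxKr.
- split=> [/prod_graphP[/(Ht _ _ Hx) <- <-]|->]; first by rewrite hsubmxK.
  by apply/prod_graphP; rewrite row_mxKl row_mxKr; split=> //; apply/Ht.
- split=> [/prod_graphP[/(Ht' _ _ Hy) <- <-]|->]; first by rewrite hsubmxK.
  by apply/prod_graphP; rewrite row_mxKl row_mxKr; split=> //; apply/Ht'.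
Qed.

Definition formulary_point : formulary 0 := formulary1 (schemic_formula [::]).

Lemma defset_point (R : comUnitAlgType F) (x : 'rV[R]_0) :
  defset formulary_point x.
Proof. by apply/defset1/sat_schemic. Qed.

Lemma schemic_iso_prodC n m (Phi : formulary n) (Psi : formulary m) :
  schemic_iso (formulary_prod Phi Psi) (formulary_prod Psi Phi).
Proof.
pose sw a b (i : 'I_(a + b)) : 'I_(b + a) :=
  unsplit (match split i with inl j => inr j | inr j => inl j end).
have swK a b : cancel (@sw a b) (@sw b a).
  move=> i; rewrite {1}/sw unsplitK -[RHS]splitK.
  by case: (split i).
apply: (@schemic_iso_perm _ _ _ _ (@sw m n) (@sw n m)) => // R x.
have E1 : lsubmx (colsub (@sw m n) x) = rsubmx x.
  apply/rowP=> j; rewrite !mxE; congr (x _ _).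
  by rewrite /sw (unsplitK (inl j)).
have E2 : rsubmx (colsub (@sw m n) x) = lsubmx x.
  apply/rowP=> j; rewrite !mxE; congr (x _ _).
  by rewrite /sw (unsplitK (inr j)).
split=> /defset_prod[H1 H2]; apply/defset_prod; first by rewrite E1 E2.
by rewrite E1 E2 in H1 H2.
Qed.

Lemma schemic_iso_prodA n m k (Phi : formulary n) (Psi : formulary m)
    (Omega : formulary k) :
  schemic_iso (formulary_prod Phi (formulary_prod Psi Omega))
              (formulary_prod (formulary_prod Phi Psi) Omega).
Proof.
have e : (n + m + k = n + (m + k))%N by rewrite addnA.
apply: (@schemic_iso_perm _ _ _ _ (cast_ord e) (cast_ord (esym e))).
- exact: cast_ordK.
- exact: cast_ordKV.
move=> R x.
have E1 : lsubmx (lsubmx (colsub (cast_ord e) x)) = lsubmx x.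
  by apply/rowP=> j; rewrite !mxE; congr (x _ _); apply: val_inj.
have E2 : rsubmx (lsubmx (colsub (cast_ord e) x)) = lsubmx (rsubmx x).
  by apply/rowP=> j; rewrite !mxE; congr (x _ _); apply: val_inj.
have E3 : rsubmx (colsub (cast_ord e) x) = rsubmx (rsubmx x).
  by apply/rowP=> j; rewrite !mxE; congr (x _ _); apply: val_inj => /=; lia.
split=> [/defset_prod[H1 /defset_prod[H2 H3]]|/defset_prod[/defset_prod[H1 H2] H3]].
  apply/defset_prod; rewrite E3; split=> //; apply/defset_prod.
  by rewrite E1 E2.
rewrite E1 E2 E3 in H1 H2 H3.
by apply/defset_prod; split=> //; apply/defset_prod.
Qed.

Lemma schemic_iso_prod1 n (Phi : formulary n) :
  schemic_iso (formulary_prod formulary_point Phi) Phi.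
Proof.
apply: (@schemic_iso_perm _ _ _ _ (fun i : 'I_n => i : 'I_(0 + n))
          (fun i : 'I_(0 + n) => i : 'I_n)) => // R x.
have E : rsubmx (x : 'rV_(0 + n)) = colsub (fun i : 'I_n => i : 'I_(0 + n)) x.
  by apply/rowP=> j; rewrite !mxE; congr (x _ _); apply: val_inj.
split=> [/defset_prod[_]|H]; first by rewrite E.
by apply/defset_prod; split; [exact: defset_point|rewrite E].
Qed.

Local Notation free := {freeg PPoo / int}.

(* No relation makes the class of the empty formulary 0: it is an idempotent e
   with e * [Phi] = e for every Phi, and disjoint unions satisfy
   [Phi \/ Psi] = [Phi] + [Psi] - e. *)
Inductive Groo_relation : free -> Prop :=
| Groo_iso n m (Phi : formulary n) (Psi : formulary m) of schemic_iso Phi Psi :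
    Groo_relation (<< PPoo_class Phi >> - << PPoo_class Psi >>)
| Groo_scissor n (Phi Psi : formulary n) :
    Groo_relation
      (<< PPoo_class (formulary_join Phi Psi) >>
       + << PPoo_class (formulary_meet Phi Psi) >>
       - << PPoo_class Phi >> - << PPoo_class Psi >>).

Definition Groo := @Quotient.quot free (subgroup_pred Groo_relation).

HB.instance Definition _ := GRing.Zmodule.on Groo.

Definition Groo_proj (D : free) : Groo :=
  \pi_(@Quotient.quot free (subgroup_pred Groo_relation)) D.

Lemma Groo_projP D E :
  Groo_proj D = Groo_proj E <-> subgroup_gen Groo_relation (D - E).
Proof.
rewrite /Groo_proj; split=> [/eqP|DE].
  by rewrite -Quotient.idealrBE => /asboolP.
by apply/eqP; rewrite -Quotient.idealrBE; apply/asboolP.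
Qed.

Lemma Groo_projB : zmod_morphism Groo_proj.
Proof. by move=> x y; rewrite /Groo_proj !piE. Qed.

HB.instance Definition _ := GRing.isZmodMorphism.Build _ _ Groo_proj Groo_projB.

Definition free_mul (D E : free) : free :=
  fglift (fun u => fglift (fun v => << PPoo_prod u v >>) E) D.

Lemma free_ind (P : free -> Prop) :
  P 0 -> (forall D E, P D -> P E -> P (D + E)) -> (forall D, P D -> P (- D)) ->
  (forall n (Phi : formulary n), P << PPoo_class Phi >>) -> forall D, P D.
Proof.
move=> P0 PD PN PU D; rewrite -(freeg_sumE D).
apply: (big_ind P) => // u _; elim/PPoo_ind: u => n Phi.
set c := coeff _ _; have Pn k : P << k%:R *g PPoo_class Phi >>.
  elim: k => [|k IH]; first by rewrite freegU0.
  by rewrite -natr1 -freegUD; apply: PD.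
by case: c => k; [|rewrite NegzE -freegUN; apply: PN];
  rewrite -[X in << X *g _ >>]intz -pmulrn; apply: Pn.
Qed.

Lemma free_mulBl D1 D2 E : free_mul (D1 - D2) E = free_mul D1 E - free_mul D2 E.
Proof. exact: lift_is_additive. Qed.

Lemma free_mulBr D E1 E2 : free_mul D (E1 - E2) = free_mul D E1 - free_mul D E2.
Proof.
rewrite /free_mul -(freeg_repr D) !fglift_Freeg /prelift -sumrB.
by apply: eq_bigr => x _; rewrite lift_is_additive scalerBr.
Qed.

Lemma free_mul0 D : free_mul D 0 = 0.
Proof. by have := free_mulBr D 0 0; rewrite !subrr. Qed.

Lemma free_mul0l D : free_mul 0 D = 0.
Proof. by have := free_mulBl 0 0 D; rewrite !subrr. Qed.

Lemma free_mulNl D E : free_mul (- D) E = - free_mul D E.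
Proof. by rewrite -sub0r free_mulBl free_mul0l sub0r. Qed.

Lemma free_mulNr D E : free_mul D (- E) = - free_mul D E.
Proof. by rewrite -sub0r free_mulBr free_mul0 sub0r. Qed.

Lemma free_mulDr D E1 E2 : free_mul D (E1 + E2) = free_mul D E1 + free_mul D E2.
Proof. by rewrite -[E2]opprK free_mulBr (free_mulNr D (- E2)). Qed.

Lemma free_mulDl D1 D2 E : free_mul (D1 + D2) E = free_mul D1 E + free_mul D2 E.
Proof. by rewrite -[D2]opprK free_mulBl (free_mulNl (- D2)). Qed.

Lemma free_mulU n m (Phi : formulary n) (Psi : formulary m) :
  free_mul << PPoo_class Phi >> << PPoo_class Psi >> =
  << PPoo_class (formulary_prod Phi Psi) >>.
Proof. by rewrite /free_mul !liftU !scale1r PPoo_prod_class. Qed.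

Lemma subgroup_genD (V : zmodType) (S : V -> Prop) x y :
  subgroup_gen S x -> subgroup_gen S y -> subgroup_gen S (x + y).
Proof.
move=> Hx Hy; rewrite -[y]opprK; apply: subgroup_genB => //.
by rewrite -sub0r; apply: subgroup_genB => //; apply: subgroup_gen0.
Qed.

Lemma subgroup_genN (V : zmodType) (S : V -> Prop) x :
  subgroup_gen S x -> subgroup_gen S (- x).
Proof. by move=> Hx; rewrite -sub0r; apply/subgroup_genB/Hx/subgroup_gen0. Qed.

Local Notation N := (subgroup_gen Groo_relation).

Lemma Groo_mulCN D E : N (free_mul D E - free_mul E D).
Proof.
elim/free_ind: D => [|D1 D2 H1 H2|D H|n Phi].
- by rewrite free_mul0 free_mul0l subrr; apply: subgroup_gen0.
- by rewrite free_mulDl free_mulDr opprD addrACA; apply: subgroup_genD.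
- by rewrite free_mulNl free_mulNr -opprD; apply: subgroup_genN.
elim/free_ind: E => [|E1 E2 H1 H2|E H|m Psi].
- by rewrite free_mul0 free_mul0l subrr; apply: subgroup_gen0.
- by rewrite free_mulDl free_mulDr opprD addrACA; apply: subgroup_genD.
- by rewrite free_mulNl free_mulNr -opprD; apply: subgroup_genN.
rewrite !free_mulU; apply/subgroup_gen_in/Groo_iso/schemic_iso_prodC.
Qed.

Lemma Groo_mulN D E : N D -> N (free_mul D E).
Proof.
elim=> {D} [D HD||D1 D2 _ H1 _ H2]; last 2 first.
- by rewrite free_mul0l; apply: subgroup_gen0.
- by rewrite free_mulBl; apply: subgroup_genB.
elim/free_ind: E => [|E1 E2 H1 H2|E H|k Omega].
- by rewrite free_mul0; apply: subgroup_gen0.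
- by rewrite free_mulDr; apply: subgroup_genD.
- by rewrite free_mulNr; apply: subgroup_genN.
case: HD => [n m Phi Psi iso|n Phi Psi].
  rewrite free_mulBl !free_mulU.
  by apply/subgroup_gen_in/Groo_iso/schemic_iso_prodr.
rewrite !free_mulBl free_mulDl !free_mulU.
rewrite (_ : PPoo_class (formulary_prod (formulary_join _ _) _) =
   PPoo_class (formulary_join (formulary_prod Phi Omega) (formulary_prod Psi Omega))).
  rewrite (_ : PPoo_class (formulary_prod (formulary_meet _ _) _) =
     PPoo_class (formulary_meet (formulary_prod Phi Omega) (formulary_prod Psi Omega))).
    exact/subgroup_gen_in/Groo_scissor.
  apply: PPoo_classP => R x; split.
    by case/defset_prod => /defset_meet[? ?] ?; apply/defset_meet; split; apply/defset_prod.
  case/defset_meet=> /defset_prod[? ?] /defset_prod[? ?].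
  by apply/defset_prod; split=> //; apply/defset_meet.
apply: PPoo_classP => R x; split.
  by case/defset_prod => /defset_join[?|?] ?; apply/defset_join; [left|right]; apply/defset_prod.
by case/defset_join=> /defset_prod[? ?]; apply/defset_prod; split=> //; apply/defset_join; [left|right].
Qed.

Definition Groo_mul (a b : Groo) : Groo := Groo_proj (free_mul (repr a) (repr b)).

Let projK a : Groo_proj (repr a) = a.
Proof. exact: reprK. Qed.

Let projM D E : Groo_mul (Groo_proj D) (Groo_proj E) = Groo_proj (free_mul D E).
Proof.
have B D' : N (repr (Groo_proj D') - D') by apply/Groo_projP; rewrite projK.
apply/Groo_projP; set D' := repr _; set E' := repr _.
have -> : free_mul D' E' - free_mul D E =
  free_mul (D' - D) E' + (free_mul (E' - E) D + (free_mul D (E' - E) - free_mul (E' - E) D)).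
  by rewrite [X in _ = _ + X]addrC subrK free_mulBr free_mulBl addrA subrK.
apply: subgroup_genD; first exact/Groo_mulN/B.
apply: subgroup_genD; first exact/Groo_mulN/B.
exact: Groo_mulCN.
Qed.

Let projP (P : Groo -> Prop) : (forall D, P (Groo_proj D)) -> forall a, P a.
Proof. by move=> H a; rewrite -[a]projK. Qed.

Let mulC : commutative Groo_mul.
Proof.
elim/projP=> D; elim/projP=> E; rewrite !projM; exact/Groo_projP/Groo_mulCN.
Qed.

Let mulD : left_distributive Groo_mul +%R.
Proof.
elim/projP=> D; elim/projP=> E; elim/projP=> G.
by rewrite -raddfD !projM free_mulDl raddfD.
Qed.

Let mul1 : left_id (Groo_proj << PPoo_class formulary_point >>) Groo_mul.
Proof.
elim/projP; elim/free_ind => [|D E HD HE|D HD|n Phi].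
- by rewrite projM free_mul0.
- by rewrite projM free_mulDr !raddfD /= -!projM HD HE.
- by rewrite projM free_mulNr !raddfN /= -!projM HD.
rewrite projM free_mulU.
exact/Groo_projP/subgroup_gen_in/Groo_iso/schemic_iso_prod1.
Qed.

Let mulA : associative Groo_mul.
Proof.
elim/projP=> D; elim/projP=> E; elim/projP=> G; rewrite !projM.
elim/free_ind: D => [|D1 D2 H1 H2|D H|n Phi].
- by rewrite !free_mul0l.
- by rewrite !free_mulDl !raddfD /= H1 H2.
- by rewrite !free_mulNl !raddfN /= H.
elim/free_ind: E => [|E1 E2 H1 H2|E H|m Psi].
- by rewrite !(free_mul0l, free_mul0).
- by rewrite !(free_mulDl, free_mulDr) !raddfD /= H1 H2.
- by rewrite !(free_mulNl, free_mulNr) !raddfN /= H.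
elim/free_ind: G => [|E1 E2 H1 H2|E H|k Omega].
- by rewrite !free_mul0.
- by rewrite !free_mulDr !raddfD /= H1 H2.
- by rewrite !free_mulNr !raddfN /= H.
rewrite !free_mulU.
exact/Groo_projP/subgroup_gen_in/Groo_iso/schemic_iso_prodA.
Qed.

HB.instance Definition _ :=
  GRing.Zmodule_isComPzRing.Build Groo mulA mulC mul1 mulD.

Definition Groo_class n (Phi : formulary n) : Groo :=
  Groo_proj << PPoo_class Phi >>.

Lemma Groo_class_iso n m (Phi : formulary n) (Psi : formulary m) :
  schemic_iso Phi Psi -> Groo_class Phi = Groo_class Psi.
Proof. by move=> H; apply/Groo_projP/subgroup_gen_in/Groo_iso. Qed.

Lemma Groo_class_scissor n (Phi Psi : formulary n) :
  Groo_class (formulary_join Phi Psi) + Groo_class (formulary_meet Phi Psi) =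
  Groo_class Phi + Groo_class Psi.
Proof.
apply/eqP; rewrite -subr_eq0 -(raddfD Groo_proj) -(raddfD Groo_proj) -raddfB.
rewrite -(raddf0 Groo_proj); apply/eqP/Groo_projP; rewrite subr0 opprD addrA.
exact/subgroup_gen_in/Groo_scissor.
Qed.

Lemma Groo_class_prod n m (Phi : formulary n) (Psi : formulary m) :
  Groo_class (formulary_prod Phi Psi) = Groo_class Phi * Groo_class Psi.
Proof. by rewrite /Groo_class -free_mulU -projM. Qed.

Fixpoint power_gens n (h : schemic n) (k : nat) : schemic n :=
  if k is k'.+1 then [seq a * b | a <- h, b <- power_gens h k'] else [:: 1].

Definition same_ideal n (psi psi' : schemic n) : Prop :=
  forall f, ideal_gen (fun e => e \in psi) f <-> ideal_gen (fun e => e \in psi') f.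

(* V = Spec B with B = F[x]/(g), I = hB and Y = Spec F[x]/(g, h): the schemic
   formulae defining the closed subschemes Spec (B/I^k) of A^n, k >= 1. *)
Definition jet_formulae n (g h : schemic n) (chi : formula n) : Prop :=
  exists k psi, [/\ (0 < k)%N, same_ideal psi (g ++ power_gens h k)
                  & chi = schemic_formula psi].

Lemma schemic_sat_ideal (R : comUnitAlgType F) n (psi : schemic n) (x : 'rV[R]_n) f :
  schemic_sat psi x -> ideal_gen (fun e => e \in psi) f -> value x f = 0.
Proof.
move=> H; elim=> [e|||a e _ He]; first exact: H.
- exact: raddf0.
- by move=> a b _ Ha _ Hb; rewrite valueD Ha Hb addr0.
- by rewrite valueM He mulr0.
Qed.

Lemma same_ideal_sat (R : comUnitAlgType F) n (psi psi' : schemic n) (x : 'rV[R]_n) :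
  same_ideal psi psi' -> schemic_sat psi x <-> schemic_sat psi' x.
Proof.
move=> E; split=> H f Hf; apply: (schemic_sat_ideal H); apply/E.
  exact: ideal_gen_in.
exact: ideal_gen_in.
Qed.

Lemma power_gensP n (h : schemic n) k f :
  f \in power_gens h k <->
  exists t, [/\ size t = k, {subset t <= h} & f = \prod_(a <- t) a].
Proof.
elim: k f => [|k IH] f /=; split.
- by rewrite inE => /eqP ->; exists [::]; rewrite big_nil.
- by case=> -[|b t] [] // _ _ ->; rewrite big_nil inE.
- case/allpairsP=> -[a b] /= [ah /IH[t [st th ->]] ->].
  exists (a :: t); rewrite big_cons /= st; split=> // c.
  by rewrite inE => /orP[/eqP ->|/th].
case=> -[|a t] [] //= [st] th ->; rewrite big_cons.
apply: allpairs_f; first by apply: th; rewrite mem_head.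
by apply/IH; exists t; split=> // c ct; apply: th; rewrite inE ct orbT.
Qed.

Lemma local_dependent (R : artinian_local_algebra) (t : seq R) (c : nat -> F) (p : R) :
  (forall y, y \in t -> y \isn't a GRing.unit) ->
  (exists2 j, (j <= size t)%N & c j != 0) ->
  p * \sum_(j < (size t).+1) c j *: \prod_(y <- take j t) y = 0 ->
  p * \prod_(y <- t) y = 0.
Proof.
have cU (a : F) : a != 0 -> (a%:A : R) \is a GRing.unit.
  by move=> a0; rewrite scaler_unit ?unitr1 ?unitfE.
elim: t c p => [|y t IH] c p tN [j jt cj] /=; rewrite big_ord_recl /= ?take0 big_nil.
  rewrite big_ord0 addr0; move: jt cj; rewrite leqn0 => /eqP -> c0.
  by move/(congr1 ( *%R^~ (c 0%N)%:A^-1)); rewrite mulrK ?cU // mul0r => ->; rewrite mul0r.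
set T := \sum_(i < _) _.
have -> : T = y * \sum_(i < (size t).+1) c i.+1 *: \prod_(z <- take i t) z.
  rewrite mulr_sumr; apply: eq_bigr => i _.
  by rewrite /bump /= add1n big_cons scalerAr.
set U := \sum_(i < _) _; have [c0|c0] := eqVneq (c 0%N) 0.
  rewrite c0 scale0r add0r mulrA big_cons mulrA; apply: (IH (c \o S)).
    by move=> z zt; apply: tN; rewrite inE zt orbT.
  by case: j jt cj => [|j] jt cj; [rewrite c0 eqxx in cj|exists j].
suff u : (c 0%N)%:A + y * U \is a GRing.unit.
  by move/(congr1 ( *%R^~ ((c 0%N)%:A + y * U)^-1)); rewrite mulrK // mul0r => ->; rewrite mul0r.
apply/negPn/negP => nu; have := cU _ c0; apply/negP.
rewrite -[_%:A](addrK (y * U)); apply: art_local => //.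
by rewrite unitrN unitrM negb_and tN // mem_head.
Qed.

Lemma art_nilpotent (R : artinian_local_algebra) : exists d, forall t : seq R,
  size t = d -> (forall y, y \in t -> y \isn't a GRing.unit) ->
  \prod_(y <- t) y = 0.
Proof.
have [s Hs] := art_finite_dimensional R; exists (size s) => t st tN.
pose P (j : nat) := \prod_(y <- take j t) y.
have /choice[m Hm] : forall j : 'I_(size s).+1, exists c : nat -> F,
    P j = \sum_(i < size s) c i *: s`_i by move=> j; apply: Hs.
pose M := \matrix_(j < (size s).+1, i < size s) m j i.
have : kermx M != 0.
  rewrite -mxrank_eq0 mxrank_ker subn_eq0 -ltnNge ltnS.
  exact: rank_leq_col.
rewrite -nz_row_eq0; set v := nz_row _ => v0.
have vM : v *m M = 0 by apply/sub_kermxP/nz_row_sub.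
have [j vj] : exists j, v 0 j != 0.
  apply/existsP; rewrite -[X in is_true X]negbK; apply/negP.
  rewrite negb_exists => /forallP H; move/eqP: v0; apply; apply/rowP=> j.
  by move: (H j); rewrite negbK mxE => /eqP.
rewrite -[LHS]mul1r; apply: (@local_dependent R t (fun j => v 0 (inord j))) => //.
  by exists j; rewrite ?inord_val // st -ltnS.
rewrite mul1r st.
transitivity (\sum_(i < size s) (v *m M) 0 i *: s`_i).
  under [RHS]eq_bigr => i _ do rewrite mxE scaler_suml.
  rewrite exchange_big; apply: eq_bigr => k _; rewrite inord_val -/(P k) Hm.
  by rewrite scaler_sumr; apply: eq_bigr => i _; rewrite mxE scalerA.
by rewrite vM big1 // => i _; rewrite mxE scale0r.
Qed.

Lemma jet_subproof n (g h : schemic n) (R : artinian_local_algebra) :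
  exists chi, jet_formulae g h chi /\
    forall x : 'rV[R]_n, sat chi x <-> defset (jet_formulae g h) x.
Proof.
have [d Hd] := art_nilpotent R.
exists (schemic_formula (g ++ power_gens h d.+1)); split.
  by exists d.+1, (g ++ power_gens h d.+1).
move=> x; split=> [H|[_ [[k [psi [k0 E ->]]] /sat_schemic]]].
  eexists; split; last exact: H.
  by exists d.+1, (g ++ power_gens h d.+1).
move/(same_ideal_sat x E) => H; apply/sat_schemic => f.
rewrite mem_cat => /orP[fg|]; first by apply: H; rewrite mem_cat fg.
case/power_gensP=> -[|a t] [] //= [st] th ->; rewrite big_cons valueM.
rewrite [X in _ * X](_ : _ = \prod_(y <- map (value x) t) y); last first.
  by rewrite big_map /value rmorph_prod.
rewrite Hd ?mulr0 ?size_map // => _ /mapP[b bt ->]; apply/negP => u.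
have : value x (b ^+ k) = 0.
  apply: H; rewrite mem_cat; apply/orP; right; apply/power_gensP.
  exists (nseq k b); rewrite size_nseq big_nseq -Monoid.iteropE; split=> // c.
  by rewrite mem_nseq => /andP[_ /eqP ->]; apply: th; rewrite inE bt orbT.
have -> : value x (b ^+ k) = value x b ^+ k by exact: rmorphXn.
by move=> bk; move: (unitrX k u); rewrite bk unitr0.
Qed.

Definition total_jet n (g h : schemic n) : formulary n :=
  Formulary (jet_subproof g h).

Definition scheme_class n (psi : schemic n) : Groo :=
  Groo_class (formulary1 (schemic_formula psi)).

Definition formal_relation (z : Groo) : Prop :=
  exists n (g h : schemic n),
    z = Groo_class (total_jet g h) - scheme_class (g ++ h).

Definition Grform := ideal_quotient formal_relation.

HB.instance Definition _ := GRing.ComPzRing.on Grform.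

Definition Grform_class n (Phi : formulary n) : Grform :=
  ideal_proj formal_relation (Groo_class Phi).

Definition Grform_scheme n (psi : schemic n) : Grform :=
  ideal_proj formal_relation (scheme_class psi).

Definition Lefschetz : Grform := Grform_scheme ([::] : schemic 1).

Definition Grform_L := localization Lefschetz.

HB.instance Definition _ := GRing.ComPzRing.on Grform_L.

(* f(x_0 + x_1 xi + ... + x_(n-1) xi^(n-1)) as a polynomial in xi; the j-th
   coordinate of x_k is the variable of index mxvec_index k j. *)
Definition arc_expansion m n (f : {mpoly F[m]}) : {poly {mpoly F[n * m]}} :=
  mmap (fun c => (c%:MP)%:P)
       (fun j => \sum_(k < n) ('X_(mxvec_index k j))%:P * 'X^k) f.

Definition linear_arcs m n (psi : schemic m) : schemic (n * m) :=
  [seq (arc_expansion n f)`_k | f <- psi, k <- iota 0 n].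

Definition Igusa_geom m (psi : schemic m) : power_series Grform :=
  fun n => Grform_scheme (linear_arcs n psi).

(* Jacobian criterion, at the closed points of the scheme f = 0 with f != 0 over
   an algebraically closed field *)
Definition singular_point m (f : {mpoly F[m]}) (P : 'rV[F]_m) : Prop :=
  f.@[P 0] = 0 /\ forall i, (f^`M(i)).@[P 0] = 0.

(* D(g) is the open neighbourhood of P that isolates it *)
Definition isolated_singularity m (f : {mpoly F[m]}) (P : 'rV[F]_m) : Prop :=
  singular_point f P /\
  exists2 g : {mpoly F[m]}, g.@[P 0] != 0 &
    forall Q : 'rV[F]_m, singular_point f Q -> g.@[Q 0] != 0 -> Q = P.

Definition power_polynomial m (r : 'I_m -> F) (a : 'I_m -> nat) : {mpoly F[m]} :=
  \sum_(i < m) r i *: 'X_i ^+ a i.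
End Formulae.

(* Main.v *)
Require Import Defs.
From HB Require Import structures.
From mathcomp Require Import all_boot all_order all_algebra.
From mathcomp Require Import boolp zify ring.
From mathcomp.multinomials Require Import mpoly freeg.

Set Implicit Arguments.
Unset Strict Implicit.
Unset Printing Implicit Defensive.

Import GRing.Theory.
Local Open Scope ring_scope.

(** Write x_j = sum_k x_(k,j) 'X^k for the coordinates of an arc modulo 'X^n on the
    hypersurface f = sum_j r_j x_j ^+ a_j = 0, and give the coefficient x_(k,j) the
    weight k a_j.  Stratum T consists of the arcs all of whose coefficients of weight
    less than T vanish.  Stratum 0 is the n-th linear arc scheme.

    Let T < n.  On stratum T the equation of degree T is sum_j r_j x_(T/a_j,j) ^+ a_j = 0,
    over the j such that a_j divides T.  The part of the stratum where the coefficients of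
    weight T are nonunits is an infinitesimal neighbourhood of stratum T + 1, so the
    relation between a total jet and its closed subscheme gives them the same class
    (set_class_stratumS).  On the rest, some coefficient x_(k,i) of weight T is a unit, and
    the isolated singularity allows i to be chosen with a_i nonzero in F (all_nonunit).
    By Hensel's lemma (exp_root_exists, exp_root_unique) the equations of degree between
    T and n can then be solved for coefficients of x_i.  The other coefficients are free,
    and there are m - 1 more of them each time n increases by 1.  So the class of this part
    is a constant multiple of the powers of L ^+ (m - 1) (set_class_leading).

    Let A be a common multiple of the a_j.  On stratum A one can write
    x_j = 'X^(A/a_j) y_j and divide the equation by 'X^A: the stratum is the product of the
    arc scheme modulo 'X^(n - A) with an affine space whose dimension does not depend on n
    (set_class_period).  Going from stratum 0 to stratum A therefore gives
    [nabla_(n+A) X] = L ^+ s [nabla_n X] + c0 + c L ^+ ((m - 1) n), where c0 collects the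
    corrections due to the class of the empty set (Igusa_recurrence).  A series that obeys
    such a recurrence is rational (ps_rational_recurrence).

    The origin is isolated among the singular points only if all r_i are nonzero and at
    most one a_i vanishes in F: otherwise a coordinate axis, or a curve in a coordinate
    plane, is singular (isolated_power_sum). *)

(** * Rational power series *)

Section SeriesRing.
Variable C : comPzRingType.

(** An alias of the type of power series that carries the convolution product as its
    ring structure. *)
Definition series := nat -> C.
Implicit Types f g h : series.

HB.instance Definition _ := gen_eqMixin series.
HB.instance Definition _ := gen_choiceMixin series.

Let sadd f g : series := fun n => f n + g n.
Let sopp f : series := fun n => - f n.

Fact series_addA : associative sadd.
Proof. by move=> f g h; apply/funext=> n; rewrite /sadd addrA. Qed.
Fact series_addC : commutative sadd.
Proof. by move=> f g; apply/funext=> n; rewrite /sadd addrC. Qed.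
Fact series_add0 : left_id (fun=> 0 : C) sadd.
Proof. by move=> f; apply/funext=> n; rewrite /sadd add0r. Qed.
Fact series_addN : left_inverse (fun=> 0 : C) sopp sadd.
Proof. by move=> f; apply/funext=> n; rewrite /sadd addNr. Qed.

HB.instance Definition _ :=
  GRing.isZmodule.Build series series_addA series_addC series_add0 series_addN.

Lemma ps_mul_rev f g n : ps_mul f g n = \sum_(i < n.+1) f (n - i)%N * g i.
Proof.
rewrite /ps_mul (reindex_inj rev_ord_inj) /=.
by apply: eq_bigr => i _; rewrite subSS subKn // -ltnS.
Qed.

Fact ps_mulC : commutative (@ps_mul C).
Proof.
move=> f g; apply/funext=> n; rewrite ps_mul_rev.
by apply: eq_bigr => i _; rewrite mulrC.
Qed.

Fact ps_mulA : associative (@ps_mul C).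
Proof.
move=> f g h; apply/funext=> n; rewrite [RHS]ps_mul_rev.
transitivity (\sum_(i < n.+1) \sum_(j < n.+1 | (j <= n - i)%N)
                f i * (g (n - i - j)%N * h j)).
  apply: eq_bigr => i _; rewrite ps_mul_rev big_distrr /=.
  rewrite (big_ord_narrow_leq (leq_subr i n) (F := fun j => f i * (g (n - i - j)%N * h j))) /=.
  exact: eq_bigr.
rewrite (exchange_big_dep predT) //=; apply: eq_bigr => j _.
rewrite /ps_mul big_distrl /=.
rewrite (eq_bigl (fun i : 'I_n.+1 => i <= n - j)%N); last first.
  by move=> i; have := ltn_ord i; have := ltn_ord j; lia.
rewrite (big_ord_narrow_leq (leq_subr j n) (F := fun i => f i * (g (n - i - j)%N * h j))) /=.
by apply: eq_bigr => i _; rewrite -!subnDA addnC mulrA.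
Qed.

Fact ps_mul1 : left_id (@ps_one C) (@ps_mul C).
Proof.
move=> f; apply/funext=> n; rewrite /ps_mul big_ord_recl big1 => [|i _].
  by rewrite /ps_one eqxx mul1r subn0 addr0.
by rewrite /ps_one mul0r.
Qed.

Fact ps_mulDl : left_distributive (@ps_mul C) sadd.
Proof.
move=> f g h; apply/funext=> n; rewrite /ps_mul /sadd -big_split /=.
by apply: eq_bigr => i _; rewrite mulrDl.
Qed.

HB.instance Definition _ :=
  GRing.Zmodule_isComPzRing.Build series ps_mulA ps_mulC ps_mul1 ps_mulDl.

Lemma ps_polynomialD f g :
  ps_polynomial f -> ps_polynomial g -> ps_polynomial (f + g : series).
Proof.
move=> [d Hd] [e He]; exists (d + e)%N => n Hn.
by rewrite -[LHS]/(f n + g n) Hd ?He ?addr0 //; lia.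
Qed.

Lemma ps_polynomialM f g :
  ps_polynomial f -> ps_polynomial g -> ps_polynomial (f * g : series).
Proof.
move=> [d Hd] [e He]; exists (d + e)%N => n Hn; rewrite -[LHS]/(ps_mul f g n).
apply: big1 => i _; have [di|id] := leqP d i; first by rewrite Hd ?mul0r.
by rewrite He ?mulr0 //; lia.
Qed.

Definition monomial_series (c : C) (e : nat) : series := fun n => c *+ (n == e).

Lemma ps_polynomial_monomial c e : ps_polynomial (monomial_series c e).
Proof. by exists e.+1 => n en; rewrite /monomial_series gtn_eqF. Qed.

Lemma monomial_seriesM c e f n :
  (monomial_series c e * f) n = if (n < e)%N then 0 else c * f (n - e)%N.
Proof.
rewrite -[LHS]/(ps_mul _ _ _) /ps_mul /monomial_series; case: ltnP => en.
  by rewrite big1 // => i _; rewrite ltn_eqF ?mul0r //; have := ltn_ord i; lia.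
rewrite (bigD1 (Ordinal (en : (e < n.+1)%N))) //= eqxx big1 ?addr0 // => i.
by rewrite -val_eqE /= => /negbTE ->; rewrite mul0r.
Qed.

(** Such an f equals (f_low + t^d h) / (1 - mu t^d), where f_low is the part of
    f of degree less than d. *)
Lemma ps_rational_recurrence (d : nat) (mu : C) f h :
  (0 < d)%N -> (forall n, f (n + d)%N = mu * f n + h n) ->
  ps_rational h -> ps_rational f.
Proof.
move=> d0 Ef [p [q [q' [Pp Pq qq' Eh]]]].
pose low : series := fun n => if (n < d)%N then f n else 0.
pose Q : series := 1 - monomial_series mu d.
pose G : series := fun n => if (d %| n)%N then mu ^+ (n %/ d) else 0.
have QG : Q * G = 1.
  apply/funext=> n; rewrite mulrBl mul1r.
  rewrite -[LHS]/(G n - (monomial_series mu d * G) n) monomial_seriesM.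
  rewrite -[(1 : series) n]/((n == 0)%:R) /G; case: ltnP => nd.
    case: n nd => [|n] nd; first by rewrite dvdn0 div0n expr0 subr0.
    by rewrite gtnNdvd // subrr.
  rewrite -{1 2}(subnK nd) dvdn_addl // divnDr // divnn d0.
  rewrite (_ : n == 0 = false); last by apply/eqP; lia.
  by case: ifP => _; rewrite ?mulr0 ?subrr // addn1 exprS subrr.
have QfE : Q * (f : series) = low + monomial_series 1 d * (h : series).
  apply/funext=> n; rewrite mulrBl mul1r.
  rewrite -[LHS]/(f n - (monomial_series mu d * (f : series)) n).
  rewrite -[RHS]/(low n + (monomial_series 1 d * (h : series)) n) !monomial_seriesM /low.
  case: ltnP => nd; first by rewrite subr0 addr0.
  by rewrite -{1}(subnK nd) Ef mul1r add0r addrAC subrr add0r.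
have qq'1 : (q : series) * q' = 1 by apply/funext.
have hE : (h : series) = (p : series) * q' by apply/funext.
exists (low * (q : series) + monomial_series 1 d * (p : series)),
  ((q : series) * Q), ((q' : series) * G); split.
- apply: ps_polynomialD; apply: ps_polynomialM => //.
    by exists d => n dn; rewrite /low ltnNge dn.
  exact: ps_polynomial_monomial.
- apply: ps_polynomialM => //; rewrite /Q; apply: ps_polynomialD.
    by exists 1%N => -[|n] // _.
  have [e He] := ps_polynomial_monomial mu d; exists e => n en.
  by rewrite -[LHS]/(- (monomial_series mu d n)) He ?oppr0.
- move=> n; rewrite -[LHS]/((((q : series) * Q) * ((q' : series) * G)) n).
  by rewrite mulrACA qq'1 QG mulr1.
- move=> n; rewrite -[RHS]/(((low * (q : series) + monomial_series 1 d * (p : series))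
                             * ((q' : series) * G)) n).
  congr (_ n); transitivity ((Q * G) * (f : series)); first by rewrite QG mul1r.
  have -> : Q * G * (f : series) = Q * (f : series) * G by ring.
  rewrite QfE hE mulrDl.
  have aux (a b u v w g : series) :
    a * (u * v) * g + b * (w * v) * g = (a * u + b * w) * (v * g) by ring.
  by rewrite -[low in LHS]mulr1 -qq'1; apply: aux.
Qed.

(** This sequence satisfies a recurrence of order 1 whose inhomogeneous part is constant,
    and a constant sequence satisfies one that is homogeneous. *)
Lemma ps_rational_geometric (c0 c lam : C) :
  ps_rational (fun n => c0 + c * lam ^+ n).
Proof.
pose k := c0 - lam * c0.
apply: (@ps_rational_recurrence 1 lam _ (fun=> k)) => // [n|].
  by rewrite addn1 exprS /k; ring.
apply: (@ps_rational_recurrence 1 1 _ (fun=> 0)) => // [n|].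
  by rewrite mul1r addr0.
exists (fun=> 0), (1 : series), (1 : series); split.
- by exists 0%N.
- by exists 1%N => -[|n].
- by move=> n; rewrite -[LHS]/((1 * 1 : series) n) mulr1.
- by move=> n; rewrite -[RHS]/((0 * 1 : series) n) mul0r.
Qed.
End SeriesRing.

(** * Classes of definable sets of points *)

Section PointSets.
Variable F : fieldType.
Local Notation Art := (artinian_local_algebra F).

(** The class of a formulary depends only on the sets of points that it defines, and
    permuting its variables does not change it.  So classes are computed on families of
    subsets of the R ^ T, where T is any finite type of variables. *)
Definition pointset (T : finType) := forall R : Art, (T -> R) -> Prop.

Definition coords (T : finType) (R : Art) (x : 'rV[R]_#|T|) : T -> R :=
  fun t => x 0 (enum_rank t).

Definition row_of (T : finType) (R : Art) (x : T -> R) : 'rV[R]_#|T| :=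
  \row_i x (enum_val i).

Lemma row_ofK (T : finType) (R : Art) : cancel (@row_of T R) (@coords T R).
Proof. by move=> x; apply/funext=> t; rewrite /coords mxE enum_rankK. Qed.

Lemma coordsK (T : finType) (R : Art) : cancel (@coords T R) (@row_of T R).
Proof. by move=> x; apply/rowP=> i; rewrite mxE /coords enum_valK. Qed.

Lemma pointsetP (T : finType) (S S' : pointset T) :
  (forall R x, S R x <-> S' R x) -> S = S'.
Proof. by move=> H; apply/functional_extensionality_dep=> R; apply/funext=> x; apply/propext. Qed.

(** The variable t : T is the coordinate of index sigma t of the formulary. *)
Definition presents d (Phi : formulary F d) (T : finType) (sigma : T -> 'I_d)
    (S : pointset T) : Prop :=
  bijective sigma /\
  forall (R : Art) (x : 'rV[R]_d), defset Phi x <-> S R (fun t => x 0 (sigma t)).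

(** Two presentations of S differ by a permutation of the coordinates, which is a schemic
    isomorphism. *)
Lemma presents_class d d' (Phi : formulary F d) (Psi : formulary F d')
    (T : finType) (sigma : T -> 'I_d) (tau : T -> 'I_d') (S : pointset T) :
  presents Phi sigma S -> presents Psi tau S ->
  Grform_class Phi = Grform_class Psi.
Proof.
move=> [[sigma' sK sK'] HPhi] [[tau' tK tK'] HPsi]; congr (ideal_proj _ _).
apply/Groo_class_iso/(@schemic_iso_perm _ _ _ _ _ (sigma \o tau') (tau \o sigma')).
- by move=> j /=; rewrite sK tK'.
- by move=> j /=; rewrite tK sK'.
move=> R x; rewrite HPhi HPsi.
suff -> : (fun t => colsub (sigma \o tau') x 0 (tau t)) = (fun t => x 0 (sigma t)) by [].
by apply/funext=> t; rewrite mxE /= tK.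
Qed.

Definition is_set_class (T : finType) (S : pointset T) (c : Grform F) : Prop :=
  exists d (Phi : formulary F d) (sigma : T -> 'I_d),
    presents Phi sigma S /\ c = Grform_class Phi.

(** The default value 0 is taken when no formulary presents S. *)
Definition set_class (T : finType) (S : pointset T) : Grform F :=
  if pselect (exists c, is_set_class S c) is left H then sval (cid H) else 0.

Lemma set_classE d (Phi : formulary F d) (T : finType) (sigma : T -> 'I_d) (S : pointset T) :
  presents Phi sigma S -> set_class S = Grform_class Phi.
Proof.
move=> H; rewrite /set_class; case: pselect => [E|[]]; last first.
  by exists (Grform_class Phi), d, Phi, sigma.
by case: (cid E) => c [d' [Phi' [sigma' [H' cE]]]] /=; rewrite cE; apply: presents_class H' H.
Qed.

Definition formula_def (T : finType) (S : pointset T) : Prop :=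
  exists phi : formula F #|T|, forall R x, sat phi x <-> S R (coords x).

Definition schemic_def (T : finType) (S : pointset T) : Prop :=
  exists psi : schemic F #|T|, forall (R : Art) (x : 'rV[R]_#|T|),
    schemic_sat psi x <-> S R (coords x).

Lemma presents_formula (T : finType) (S : pointset T) (phi : formula F #|T|) :
  (forall R x, sat phi x <-> S R (coords x)) ->
  presents (formulary1 phi) enum_rank S.
Proof.
move=> H; split; first exact: enum_rank_bij.
by move=> R x; rewrite defset1 H.
Qed.

Lemma schemic_formula_def (T : finType) (S : pointset T) : schemic_def S -> formula_def S.
Proof. by move=> [psi H]; exists (schemic_formula psi) => R x; rewrite sat_schemic. Qed.

Lemma formula_def_and (T : finType) (S S' : pointset T) :
  formula_def S -> formula_def S' -> formula_def (fun R x => S R x /\ S' R x).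
Proof. by move=> [phi H] [psi H']; exists (And phi psi) => R x /=; rewrite H H'. Qed.

Lemma formula_def_not (T : finType) (S : pointset T) :
  formula_def S -> formula_def (fun R x => ~ S R x).
Proof. by move=> [phi H]; exists (Not phi) => R x /=; rewrite H. Qed.

Lemma formula_def_unit (T : finType) (t : T) :
  formula_def (fun R x => x t \is a GRing.unit).
Proof.
pose f : {mpoly F[#|T| + 1]} :=
  'X_(lshift 1 (enum_rank t)) * 'X_(rshift #|T| ord0) - 1.
have fE (R : Art) x (y : 'rV[R]_1) : value (row_mx x y) f = coords x t * y 0 ord0 - 1.
  rewrite valueB valueM !valueX row_mxEl row_mxEr; congr (_ - _).
  by rewrite /value rmorph1.
exists (PPAtom (@PPFormula F #|T| 1 [:: f])) => R x /=; split=> [[y H]|u].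
  have := H f; rewrite mem_head fE => /(_ isT)/eqP; rewrite subr_eq0 => /eqP E.
  by apply/unitrPr; exists (y 0 ord0).
exists (const_mx (coords x t)^-1) => _ /[!inE] /eqP ->.
by rewrite fE mxE mulrV // subrr.
Qed.

Lemma formula_def_True (T : finType) : formula_def (fun R (x : T -> R) => True).
Proof. by exists (schemic_formula [::]) => R x; rewrite sat_schemic; split. Qed.

Lemma formula_def_if (T : finType) (b : bool) (S : pointset T) :
  formula_def S -> formula_def (fun R x => b -> S R x).
Proof.
case: b => [[phi H]|_]; first by exists phi => R x; rewrite H; split=> // /(_ isT).
by have [phi H] := formula_def_True T; exists phi => R x; rewrite H.
Qed.

Lemma formula_def_forall (I T : finType) (S : I -> pointset T) :
  (forall i, formula_def (S i)) -> formula_def (fun R x => forall i, S i R x).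
Proof.
move=> H; suff [phi Hphi] : formula_def (fun R x => forall i, i \in enum I -> S i R x).
  by exists phi => R x; rewrite Hphi; split=> E i //; apply: E; rewrite mem_enum.
elim: (enum I) => [|i s [phi Hphi]].
  by have [phi Hphi] := formula_def_True T; exists phi => R x; rewrite Hphi.
have [psi Hpsi] := H i; exists (And psi phi) => R x /=; rewrite Hphi Hpsi.
split=> [[E E'] j|E]; first by rewrite inE => /predU1P[->|/E'].
by split=> [|j js]; apply: E; rewrite inE ?eqxx ?js ?orbT.
Qed.

Lemma formula_def_preim (T T' : finType) (iota : T -> T') (S : pointset T) :
  formula_def S -> formula_def (fun R x => S R (x \o iota)).
Proof.
move=> [phi H].
exists (formula_rename (fun j => enum_rank (iota (enum_val j))) phi) => R x.
rewrite sat_rename H; set y := coords _; suff -> : y = coords x \o iota by [].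
by apply/funext=> t; rewrite /y /coords mxE enum_rankK.
Qed.

Lemma schemic_def_and (T : finType) (S S' : pointset T) :
  schemic_def S -> schemic_def S' -> schemic_def (fun R x => S R x /\ S' R x).
Proof.
move=> [phi H] [psi H']; exists (phi ++ psi) => R x; rewrite -H -H'.
split=> [E|[E E'] f]; last by rewrite mem_cat => /orP[/E|/E'].
by split=> f fin; apply: E; rewrite mem_cat fin ?orbT.
Qed.

Lemma schemic_def_if (T : finType) (b : bool) (S : pointset T) :
  schemic_def S -> schemic_def (fun R x => b -> S R x).
Proof.
case: b => [[psi H]|_]; first by exists psi => R x; rewrite H; split=> // /(_ isT).
by exists [::] => R x.
Qed.

Lemma schemic_def_forall (I T : finType) (S : I -> pointset T) :
  (forall i, schemic_def (S i)) -> schemic_def (fun R x => forall i, S i R x).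
Proof.
move=> /choice[psi H]; exists (flatten [seq psi i | i <- enum I]) => R x; split.
  move=> E i; apply/H => f fi; apply: E; apply/flattenP.
  by exists (psi i) => //; apply: map_f; rewrite mem_enum.
move=> E f /flattenP[_ /mapP[i _ ->]]; apply: (proj2 (H i R x) (E i)).
Qed.

(** * Scissor, product and affine space *)

Lemma set_class_scissor (T : finType) (A B : pointset T) :
  formula_def A -> formula_def B ->
  set_class (fun R x => A R x \/ B R x) + set_class (fun R x => A R x /\ B R x) =
  set_class A + set_class B.
Proof.
move=> [phi /presents_formula HA] [psi /presents_formula HB].
rewrite (set_classE HA) (set_classE HB) /Grform_class -raddfD -Groo_class_scissor raddfD.
have [b HA'] := HA; have [_ HB'] := HB.
congr (_ + _); apply: set_classE; (split; first exact: b) => R x.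
  by rewrite defset_join HA' HB'.
by rewrite defset_meet HA' HB'.
Qed.

Lemma set_class_prod (T T' : finType) (A : pointset T) (B : pointset T') :
  formula_def A -> formula_def B ->
  set_class (fun R (x : T + T' -> R) => A R (x \o inl) /\ B R (x \o inr)) =
  set_class A * set_class B.
Proof.
move=> [phi /presents_formula HA] [psi /presents_formula HB].
rewrite (set_classE HA) (set_classE HB) /Grform_class -rmorphM -Groo_class_prod.
pose sigma (t : T + T') := match t with
  | inl t => lshift #|T'| (enum_rank t) | inr t => rshift #|T| (enum_rank t) end.
apply: (@set_classE _ _ _ sigma); split.
  exists (fun i => match split i with inl j => inl (enum_val j)
                                    | inr j => inr (enum_val j) end).
    case=> t; rewrite /sigma; [have := unsplitK (inl (enum_rank t) : 'I_#|T| + 'I_#|T'|)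
      |have := unsplitK (inr (enum_rank t) : 'I_#|T| + 'I_#|T'|)];
      by rewrite /unsplit => ->; rewrite enum_rankK.
  move=> i; rewrite -[RHS]splitK; case: (split i) => j; by rewrite /sigma /= enum_valK.
move=> R x; rewrite defset_prod; case: HA HB => [_ HA] [_ HB]; rewrite HA HB.
have E1 : (fun t => lsubmx x 0 (enum_rank t)) = (fun t => x 0 (sigma t)) \o inl.
  by apply/funext=> t; rewrite mxE.
have E2 : (fun t => rsubmx x 0 (enum_rank t)) = (fun t => x 0 (sigma t)) \o inr.
  by apply/funext=> t; rewrite mxE.
by rewrite E1 E2.
Qed.

Lemma Grform_scheme_affine n : Grform_scheme ([::] : schemic F n) = Lefschetz F ^+ n.
Proof.
elim: n => [|n IH].
  rewrite expr0 -(rmorph1 (ideal_proj (@formal_relation F))); congr (ideal_proj _ _).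
rewrite exprS -IH /Lefschetz /Grform_scheme -rmorphM -Groo_class_prod.
congr (ideal_proj _ _); rewrite /scheme_class /Groo_class; congr (Groo_proj << _ >>).
apply: (@PPoo_classP F (1 + n)) => R x; rewrite defset_prod !defset1 !sat_schemic.
by split=> // _; split.
Qed.

Lemma set_class_affine (T : finType) :
  set_class (fun R (x : T -> R) => True) = Lefschetz F ^+ #|T|.
Proof.
rewrite -Grform_scheme_affine.
apply: (@set_classE _ (formulary1 (schemic_formula ([::] : schemic F #|T|))) _ enum_rank).
by apply: presents_formula => R x; rewrite sat_schemic.
Qed.

(** * Isomorphisms *)

(** The graph of an inverse of the projection x |-> colsub s x, for an inverse with values
    in the zero set of psi. *)
Definition graph_inverse n p (s : 'I_p -> 'I_n) (psi : schemic F n) : schemic F (p + n) :=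
  schemic_rename (fun i => match split i with
    | inl j => rshift p j | inr j => lshift n j end) (coord_eqs F s)
  ++ schemic_rename (@rshift p n) psi.

Lemma graph_inverseP (R : Art) n p (s : 'I_p -> 'I_n) (psi : schemic F n)
    (y : 'rV[R]_p) (x : 'rV[R]_n) :
  schemic_sat (graph_inverse s psi) (row_mx y x) <->
  y = colsub s x /\ schemic_sat psi x.
Proof.
rewrite -coord_eqsP /graph_inverse; set sw := (X in schemic_rename X (coord_eqs F s)).
have E1 : colsub sw (row_mx y x) = row_mx x y.
  apply/rowP=> i; rewrite mxE /sw -[i in RHS]splitK.
  by case: (split i) => j /=; rewrite !(row_mxEl, row_mxEr).
have E2 : colsub (@rshift p n) (row_mx y x) = x.
  by apply/rowP=> i; rewrite mxE row_mxEr.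
have := schemic_sat_rename sw (coord_eqs F s) (row_mx y x); rewrite E1 => H1.
have := schemic_sat_rename (@rshift p n) psi (row_mx y x); rewrite E2 => H2.
rewrite -H1 -H2; split=> [H|[H H'] f]; last by rewrite mem_cat => /orP[/H|/H'].
by split=> f fin; apply: H; rewrite mem_cat fin ?orbT.
Qed.

(** Forgetting coordinates is a polynomial map.  Its inverse need not be polynomial, but
    the graph of the inverse is cut out by the equations of G, and a schemic isomorphism
    asks for no more: this is how implicitly defined coordinates are eliminated. *)
Lemma set_class_iso (T T' : finType) (S : pointset T) (S' : pointset T') (G : pointset T)
    (iota : T' -> T) :
  formula_def S -> formula_def S' -> schemic_def G ->
  (forall R x, S R x -> G R x /\ S' R (x \o iota)) ->
  (forall R y, S' R y -> exists2 x, S R x & x \o iota = y) ->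
  (forall R x x', G R x -> S R x' -> x \o iota = x' \o iota -> x = x') ->
  set_class S = set_class S'.
Proof.
move=> [phi Hphi] [phi' Hphi'] [psi Hpsi] SG S'S inj.
rewrite (set_classE (presents_formula Hphi)) (set_classE (presents_formula Hphi')).
congr (ideal_proj _ _); apply: Groo_class_iso.
pose s (j : 'I_#|T'|) : 'I_#|T| := enum_rank (iota (enum_val j)).
have sE (R : Art) (x : 'rV[R]_#|T|) : colsub s x = row_of (coords x \o iota).
  by apply/rowP=> j; rewrite !mxE.
exists (coord_eqs F s), (graph_inverse s psi) => R.
have /choice[g Hg] : forall y : 'rV[R]_#|T'|, exists x : 'rV[R]_#|T|,
    S' R (coords y) -> S R (coords x) /\ colsub s x = y.
  move=> y; have [/S'S[x Sx xy]|nS] := pselect (S' R (coords y)); last by exists 0.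
  by exists (row_of x) => _; rewrite sE row_ofK xy coordsK.
have uniq (x x' : 'rV[R]_#|T|) : G R (coords x) -> S R (coords x') ->
    colsub s x = colsub s x' -> x = x'.
  move=> Gx Sx' xx'; rewrite -[x]coordsK -[x']coordsK; congr row_of; apply: inj => //.
  by apply: (can_inj (@row_ofK T' R)); rewrite -!sE.
exists (fun x => colsub s x), g; split=> [x|y|x y _|y x].
- rewrite !defset1 Hphi Hphi' => Sx; have [_ S'x] := SG _ _ Sx.
  have S'x' : S' R (coords (colsub s x)) by rewrite sE row_ofK.
  split=> //; have [Sg gx] := Hg _ S'x'.
  by apply: uniq => //; case: (SG _ _ Sg).
- by rewrite !defset1 Hphi Hphi' => /Hg[].
- exact: coord_eqsP.
rewrite defset1 Hphi' => S'y; have [Sg gy] := Hg _ S'y.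
rewrite graph_inverseP Hpsi; split=> [[yE Gx]|->].
  by apply: uniq => //; rewrite gy.
by rewrite gy; split=> //; case: (SG _ _ Sg).
Qed.

Definition empty_class : Grform F := set_class (fun R (x : void -> R) => False).

Lemma schemic_def_False (T : finType) : schemic_def (fun R (x : T -> R) => False).
Proof.
exists [:: 1] => R x; split=> [/(_ 1)|[]].
rewrite mem_head => /(_ isT); rewrite /value rmorph1 => /eqP.
by rewrite oner_eq0.
Qed.

(** Empty sets are all isomorphic, so the correction term in the additivity of classes
    is a constant. *)
Lemma set_class_empty (T : finType) : set_class (fun R (x : T -> R) => False) = empty_class.
Proof.
have H T' := @schemic_def_False T'.
apply: (@set_class_iso _ _ _ _ _ (fun v : void => match v return T with end) _ _ (H T)) => //;
  exact: schemic_formula_def.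
Qed.

Lemma set_class_split (T : finType) (A B : pointset T) :
  formula_def A -> formula_def B ->
  set_class A = set_class (fun R x => A R x /\ ~ B R x)
             + (set_class (fun R x => A R x /\ B R x) - empty_class).
Proof.
move=> HA HB; apply/eqP; rewrite addrA -subr_eq opprK eq_sym; apply/eqP.
rewrite -(set_class_empty T) -[LHS]set_class_scissor; last 2 first.
- exact/formula_def_and/formula_def_not.
- exact: formula_def_and.
congr (_ + _); congr set_class; apply: pointsetP => R x; last first.
  by split=> [[[_ nB] [_ /nB]]|].
by split=> [[[]|[]] //|Ax]; have [?|?] := pselect (B R x); [right|left].
Qed.

(** * Jets *)

(** The nonunits of an Artinian local algebra form a nilpotent ideal, so a point lies
    in some infinitesimal neighbourhood of h = 0 as soon as h takes nonunit values. *)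
Lemma defset_jet (R : Art) n (g h : schemic F n) (x : 'rV[R]_n) :
  defset (total_jet g h) x <->
  schemic_sat g x /\ forall f, f \in h -> value x f \isn't a GRing.unit.
Proof.
split=> [[_ [[k [psi [k0 E ->]]] /sat_schemic/(same_ideal_sat x E) H]]|[Hg Hh]].
  split=> [f fg|f fh]; first by apply: H; rewrite mem_cat fg.
  have fX : value x (f ^+ k) = value x f ^+ k by exact: rmorphXn.
  apply/negP=> u; have := unitrX k u; rewrite -fX.
  rewrite H ?unitr0 // mem_cat; apply/orP; right; apply/power_gensP.
  exists (nseq k f); rewrite size_nseq big_nseq -Monoid.iteropE; split=> // c.
  by rewrite mem_nseq => /andP[_ /eqP ->].
have [d Hd] := art_nilpotent R.
exists (schemic_formula (g ++ power_gens h d.+1)); split.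
  by exists d.+1, (g ++ power_gens h d.+1).
apply/sat_schemic => f; rewrite mem_cat => /orP[/Hg //|].
case/power_gensP=> -[|a t] [] //= [st] th ->; rewrite big_cons valueM.
rewrite [X in _ * X](_ : _ = \prod_(y <- map (value x) t) y); last first.
  by rewrite big_map /value rmorph_prod.
rewrite Hd ?mulr0 ?size_map // => _ /mapP[b bt ->].
by apply/Hh/th; rewrite inE bt orbT.
Qed.

Lemma Grform_jet n (g h : schemic F n) :
  Grform_class (total_jet g h) = Grform_scheme (g ++ h).
Proof. by apply/ideal_projP/ideal_gen_in; exists n, g, h. Qed.

(** The relation that defines the formal Grothendieck ring, read on points: coordinates
    that are nonunits can be replaced by 0. *)
Lemma set_class_jet (T : finType) (G : pointset T) (s : seq T) :
  schemic_def G ->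
  set_class (fun R x => G R x /\ forall t, t \in s -> x t \isn't a GRing.unit) =
  set_class (fun R x => G R x /\ forall t, t \in s -> x t = 0).
Proof.
move=> [g Hg]; pose h : schemic F #|T| := [seq 'X_(enum_rank t) | t <- s].
transitivity (Grform_class (total_jet g h)).
  apply: (@set_classE _ _ _ enum_rank); split; first exact: enum_rank_bij.
  move=> R x; rewrite defset_jet Hg; split=> -[Gx H]; split=> //.
    by move=> t ts; have := H _ (map_f _ ts); rewrite valueX.
  by move=> _ /mapP[t ts ->]; rewrite valueX; apply: H.
rewrite Grform_jet; apply/esym/(@set_classE _ (formulary1 (schemic_formula (g ++ h))) _ enum_rank).
apply: presents_formula => R x; rewrite sat_schemic -Hg.
split=> [H|[Hx H] f].
  split=> [f fg|t ts]; first by apply: H; rewrite mem_cat fg.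
  have := H 'X_(enum_rank t); rewrite valueX; apply.
  by rewrite mem_cat; apply/orP; right; apply/mapP; exists t.
by rewrite mem_cat => /orP[/Hx //|/mapP[t ts ->]]; rewrite valueX; apply: H.
Qed.

(** * Polynomial functions *)

(** A single polynomial over F has to compute p in all the algebras R. *)
Definition polyfun (T : finType) (p : forall R : Art, (T -> R) -> R) : Prop :=
  exists f : {mpoly F[#|T|]}, forall (R : Art) (x : 'rV[R]_#|T|), value x f = p R (coords x).

Lemma polyfun_var (T : finType) (t : T) : polyfun (fun R x => x t).
Proof. by exists 'X_(enum_rank t) => R x; rewrite valueX. Qed.

Lemma polyfun0 (T : finType) : @polyfun T (fun R x => 0).
Proof. by exists 0 => R x; rewrite /value raddf0. Qed.

Lemma polyfun1 (T : finType) : @polyfun T (fun R x => 1).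
Proof. by exists 1 => R x; rewrite /value rmorph1. Qed.

Lemma polyfunZ (T : finType) (c : F) (p : forall R : Art, (T -> R) -> R) :
  polyfun p -> polyfun (fun R x => c%:A * p R x).
Proof. by move=> [f Hf]; exists (c%:MP * f) => R x; rewrite valueM Hf /value mmapC. Qed.

Lemma polyfunM (T : finType) (p q : forall R : Art, (T -> R) -> R) :
  polyfun p -> polyfun q -> polyfun (fun R x => p R x * q R x).
Proof. by move=> [f Hf] [g Hg]; exists (f * g) => R x; rewrite valueM Hf Hg. Qed.

Lemma polyfun_sum (T I : finType) (p : I -> forall R : Art, (T -> R) -> R) :
  (forall i, polyfun (p i)) -> polyfun (fun R x => \sum_i p i R x).
Proof.
move=> /choice[f Hf]; exists (\sum_i f i) => R x.
by rewrite /value raddf_sum; apply: eq_bigr => i _; apply: Hf.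
Qed.

Lemma schemic_def_eq0 (T : finType) (p : forall R : Art, (T -> R) -> R) :
  polyfun p -> schemic_def (fun R x => p R x = 0).
Proof.
move=> [f Hf]; exists [:: f] => R x; rewrite -Hf; split=> [|H g /[!inE] /eqP -> //].
by apply; rewrite mem_head.
Qed.

Definition polyfun_coefs (T : finType) (p : forall R : Art, (T -> R) -> {poly R}) : Prop :=
  forall k, polyfun (fun R x => (p R x)`_k).

Lemma polyfun_ext (T : finType) (p q : forall R : Art, (T -> R) -> R) :
  (forall R x, p R x = q R x) -> polyfun p -> polyfun q.
Proof. by move=> E [f Hf]; exists f => R x; rewrite Hf E. Qed.

Lemma polyfun_coefsX (T : finType) (p : forall R : Art, (T -> R) -> {poly R}) n :
  polyfun_coefs p -> polyfun_coefs (fun R x => p R x ^+ n).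
Proof.
move=> Hp; elim: n => [|n IH] k.
  apply: (@polyfun_ext _ (fun R x => if k == 0 then 1 else 0)); last first.
    by case: (k == 0); [apply: polyfun1|apply: polyfun0].
  by move=> R x; rewrite expr0 coef1; case: (k == 0).
apply: (@polyfun_ext _ (fun R x => \sum_(i < k.+1) (p R x)`_i * (p R x ^+ n)`_(k - i))).
  by move=> R x; rewrite exprS coefM.
apply: polyfun_sum => i; exact: polyfunM.
Qed.
End PointSets.

(** * Powers of polynomials, coefficient by coefficient *)

Section PolyPowers.
Variable R : comNzRingType.
Implicit Types p q u v : {poly R}.

Lemma coef0_exp p n : (p ^+ n)`_0 = p`_0 ^+ n.
Proof. by elim: n => [|n IH]; rewrite ?expr0 ?coef1 // !exprS coef0M IH. Qed.

Lemma coef_exp_eq p q n l :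
  (forall k, (k <= l)%N -> p`_k = q`_k) -> (p ^+ n)`_l = (q ^+ n)`_l.
Proof.
elim: n l => [//|n IH] l pq; rewrite !exprS !coefM; apply: eq_bigr => i _.
rewrite pq; last by rewrite -ltnS.
by congr (_ * _); apply: IH => k kl; apply: pq; apply: leq_trans kl (leq_subr _ _).
Qed.

(** First order Taylor expansion of the power function.  The terms of higher order in q
    are divisible by 'X^(2 * l), so they do not contribute in degree l > 0. *)
Lemma expr_perturb p q l n : (0 < l)%N ->
  exists2 s, (p + q * 'X^l) ^+ n = p ^+ n + s * 'X^l
           & s`_0 = n%:R * p`_0 ^+ n.-1 * q`_0.
Proof.
move=> l0; elim: n => [|n [s Es s0]].
  by exists 0; rewrite ?expr0 ?mul0r ?addr0 ?coef0 ?mul0r.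
exists (p * s + q * p ^+ n + q * s * 'X^l).
  rewrite exprS Es exprS; move: (p ^+ n) ('X^l) => P Y; ring.
rewrite !coefD !coef0M coefXn eq_sym (gtn_eqF l0) mulr0 addr0 s0 coef0_exp /=.
rewrite -[n.+1]addn1 natrD mulrDl mulrDl mul1r; congr (_ + _); last exact: mulrC.
case: n {Es s0} => [|n] /=; first by rewrite !mul0r mulr0.
by rewrite exprS !mulrA [n.+1%:R * _]mulrC.
Qed.

Lemma coef_exp_low p l n : (forall k, (k < l)%N -> p`_k = 0) ->
  p ^+ n = drop_poly l p ^+ n * 'X^(l * n).
Proof.
move=> pl; rewrite -[p in LHS](poly_take_drop l) (_ : take_poly l p = 0).
  by rewrite add0r exprMn -exprM.
by apply/polyP=> k; rewrite coef_take_poly coef0; case: ifP => // /pl.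
Qed.

(** With d the least integer such that T <= d * n, the hypothesis says that 'X^d divides
    p.  Hence 'X^(d * n) divides p ^+ n, and the coefficient of degree T can be nonzero
    only if T = d * n. *)
Lemma coef_exp_vanish p n T : (0 < n)%N -> (forall k, (k * n < T)%N -> p`_k = 0) ->
  (forall t, (t < T)%N -> (p ^+ n)`_t = 0) /\
  (p ^+ n)`_T = if (n %| T)%N then p`_(T %/ n) ^+ n else 0.
Proof.
move=> n0 pT; have [/dvdnP[d dE]|ndiv] := boolP (n %| T)%N.
  rewrite (@coef_exp_low p d); last first.
    by move=> k kd; apply: pT; rewrite dE ltn_mul2r n0.
  split=> [t tT|]; first by rewrite coefMXn -dE tT.
  by rewrite coefMXn -dE ltnn subnn coef0_exp coef_drop_poly dE mulnK.
pose d := (T %/ n).+1; have dT : (T < d * n)%N by rewrite ltn_ceil.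
have dT' k : (k < d)%N -> (k * n < T)%N.
  rewrite ltnS => kd; rewrite ltn_neqAle; apply/andP; split.
    by apply: contra ndiv => /eqP <-; rewrite dvdn_mull.
  by apply: leq_trans (leq_trunc_div T n); rewrite leq_mul2r kd orbT.
rewrite (@coef_exp_low p d) => [|k /dT'/pT //].
split=> [t tT|]; first by rewrite coefMXn (ltn_trans tT dT).
by rewrite coefMXn dT.
Qed.
End PolyPowers.

Section Roots.
Variable R : comUnitRingType.
Implicit Types u v w : {poly R}.

(** Hensel's lemma for the equation u ^+ n = b, one coefficient at a time: in degree
    l > 0 it is linear in u`_l, with the unit n u`_0 ^+ n.-1 as coefficient.  The
    coefficients of u of degree at least M are free. *)
Lemma exp_root_exists w n M (b : nat -> R) :
  w`_0 \is a GRing.unit -> (n%:R : R) \is a GRing.unit ->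
  exists u, [/\ u`_0 = w`_0, forall l, (M <= l)%N -> u`_l = w`_l
    & forall l, (0 < l < M)%N -> (u ^+ n)`_l = b l].
Proof.
move=> w0 nU; elim: M => [|M [u [u0 uw ub]]]; first by exists w; split=> // -[].
case: (posnP M) => [->|M0].
  by exists w; split=> // -[|l].
pose c := (b M - (u ^+ n)`_M) / (n%:R * w`_0 ^+ n.-1).
exists (u + c%:P * 'X^M); have [s Es s0] := expr_perturb u c%:P n M0.
split=> [|l Ml|l /andP[l0]].
- by rewrite coefD coefMXn M0 addr0.
- rewrite coefD uw; last exact: ltnW.
  by rewrite mul_polyC coefZ coefXn gtn_eqF // mulr0 addr0.
rewrite Es coefD coefMXn ltnS leq_eqVlt => /predU1P[->|lM]; last first.
  by rewrite lM addr0 ub // l0.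
rewrite ltnn subnn s0 u0 coefC eqxx /c mulrC mulrVK ?subrKC //.
by rewrite unitrM nU unitrX.
Qed.

Lemma exp_root_unique u v n M :
  u`_0 = v`_0 -> u`_0 \is a GRing.unit -> (n%:R : R) \is a GRing.unit ->
  (forall l, (0 < l < M)%N -> (u ^+ n)`_l = (v ^+ n)`_l) ->
  forall l, (l < M)%N -> u`_l = v`_l.
Proof.
move=> uv0 u0 nU uv; elim/ltn_ind => l IH lM; case: (posnP l) => [-> //|l0].
have tuv : take_poly l u = take_poly l v.
  apply/polyP=> k; rewrite !coef_take_poly; case: ifP => // kl.
  by apply: IH => //; apply: ltn_trans kl lM.
have coefE w : (w ^+ n)`_l = (take_poly l w ^+ n)`_l + n%:R * w`_0 ^+ n.-1 * w`_l.
  have [s Es s0] := expr_perturb (take_poly l w) (drop_poly l w) n l0.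
  rewrite -[w in LHS](poly_take_drop l) Es coefD coefMXn ltnn subnn s0.
  by rewrite coef_take_poly l0 coef_drop_poly.
have := uv l; rewrite l0 lM => /(_ isT); rewrite (coefE u) (coefE v) tuv uv0 => /addrI.
by apply: mulrI; rewrite unitrM nU unitrX // -uv0.
Qed.
End Roots.

(** * Arcs on a power hypersurface *)

Section Arcs.
Variables (F : fieldType) (m : nat) (r : 'I_m -> F) (a : 'I_m -> nat).
Hypothesis a_gt0 : forall i, (0 < a i)%N.
Local Notation Art := (artinian_local_algebra F).

Definition power_sum (R : Art) (p : 'I_m -> {poly R}) : {poly R} :=
  \sum_j ((r j)%:A : R) *: p j ^+ a j.

(** The variable t is the coefficient of degree (pos t).1 in the coordinate of index
    (pos t).2 of the arc. *)
Definition arc_poly (T : finType) (pos : T -> nat * 'I_m) (R : Art) (x : T -> R)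
    (j : 'I_m) : {poly R} :=
  \sum_(t | (pos t).2 == j) x t *: 'X^((pos t).1).

Lemma arc_coef (T : finType) (pos : T -> nat * 'I_m) (R : Art) (x : T -> R) t k j :
  injective pos -> pos t = (k, j) -> (arc_poly pos x j)`_k = x t.
Proof.
move=> inj tE; rewrite /arc_poly coef_sum (bigD1 t) /=; last by rewrite tE.
rewrite coefZ coefXn tE eqxx mulr1.
rewrite big1 ?addr0 // => u /andP[/eqP uj ut]; rewrite coefZ coefXn.
case: eqP => [ku|_]; last by rewrite mulr0.
by case/eqP: ut; apply: inj; rewrite tE [pos u]surjective_pairing uj ku.
Qed.

Lemma arc_coef0 (T : finType) (pos : T -> nat * 'I_m) (R : Art) (x : T -> R) k j :
  (forall t, pos t <> (k, j)) -> (arc_poly pos x j)`_k = 0.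
Proof.
move=> H; rewrite /arc_poly coef_sum big1 // => t /eqP tj; rewrite coefZ coefXn.
case: eqP => [kt|_]; last by rewrite mulr0.
by case: (H t); rewrite [pos t]surjective_pairing tj kt.
Qed.

Lemma polyfun_power_sum (T : finType) (pos : T -> nat * 'I_m) :
  polyfun_coefs (fun (R : Art) (x : T -> R) => power_sum (arc_poly pos x)).
Proof.
move=> k; apply: (@polyfun_ext _ _
  (fun R x => \sum_j ((r j)%:A * (arc_poly pos x j ^+ a j)`_k))).
  by move=> R x; rewrite /power_sum coef_sum; apply: eq_bigr => j _; rewrite coefZ.
apply: polyfun_sum => j; apply/polyfunZ/polyfun_coefsX => l.
apply: (@polyfun_ext _ _
  (fun R x => \sum_(t : T) ((((pos t).2 == j) && (l == (pos t).1))%:R%:A * x t))).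
  move=> R x; rewrite /arc_poly coef_sum [RHS]big_mkcond; apply: eq_bigr => t _.
  rewrite coefZ coefXn; case: (_ == j) => /=; last by rewrite scale0r mul0r.
  by case: (l == _); rewrite ?scale1r ?mul1r ?mulr1 // scale0r mul0r mulr0.
by apply: polyfun_sum => t; apply/polyfunZ/polyfun_var.
Qed.

(** Each term of the sum has order at least T, and only the j such that a j divides T
    can contribute in degree T. *)
Lemma power_sum_low (R : Art) (p : 'I_m -> {poly R}) T :
  (forall j k, (k * a j < T)%N -> (p j)`_k = 0) ->
  (forall t, (t < T)%N -> (power_sum p)`_t = 0) /\
  (power_sum p)`_T =
    \sum_(j | (a j %| T)%N) (r j)%:A * (p j)`_(T %/ a j) ^+ a j.
Proof.
move=> H; split=> [t tT|]; rewrite /power_sum coef_sum.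
  rewrite big1 // => j _; rewrite coefZ.
  by have [low _] := coef_exp_vanish (a_gt0 j) (H j); rewrite low ?mulr0.
rewrite [RHS]big_mkcond; apply: eq_bigr => j _; rewrite coefZ.
by have [_ ->] := coef_exp_vanish (a_gt0 j) (H j); case: ifP; rewrite ?mulr0.
Qed.

(** A coefficient of an arc modulo 'X^n: a degree and the index of a coordinate. *)
Definition cell n := ('I_n * 'I_m)%type.

Definition cell_pos n (v : cell n) : nat * 'I_m := (val v.1, v.2).

Lemma cell_pos_inj n : injective (@cell_pos n).
Proof. by move=> [k j] [k' j'] [/val_inj -> ->]. Qed.

(** The arcs along which every x_j ^+ a_j has order at least T. *)
Definition stratum n T : pointset F (cell n) := fun R x =>
  (forall t : 'I_n, (power_sum (arc_poly (@cell_pos n) x))`_t = 0) /\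
  (forall v : cell n, (v.1 * a v.2 < T)%N -> x v = 0).

Lemma schemic_def_stratum n T : schemic_def (@stratum n T).
Proof.
apply: schemic_def_and; apply: schemic_def_forall => v.
  exact/schemic_def_eq0/polyfun_power_sum.
exact/schemic_def_if/schemic_def_eq0/polyfun_var.
Qed.

Lemma cell_coef n (R : Art) (x : cell n -> R) (v : cell n) :
  (arc_poly (@cell_pos n) x v.2)`_v.1 = x v.
Proof. by apply: arc_coef => //; apply: cell_pos_inj. Qed.

Lemma cell_coef_ge n (R : Art) (x : cell n -> R) j k :
  (n <= k)%N -> (arc_poly (@cell_pos n) x j)`_k = 0.
Proof.
by move=> nk; apply: arc_coef0 => -[l i] [lk _]; have := ltn_ord l; rewrite lk ltnNge nk.
Qed.

Lemma stratum_coef n T (R : Art) (x : cell n -> R) j k :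
  (forall v : cell n, (v.1 * a v.2 < T)%N -> x v = 0) ->
  (k * a j < T)%N -> (arc_poly (@cell_pos n) x j)`_k = 0.
Proof.
move=> xT kT; have [kn|] := ltnP k n; last exact: cell_coef_ge.
by have := cell_coef x (Ordinal kn, j) => /= ->; apply: xT.
Qed.

(** * The scheme of linear arcs *)

Lemma arc_expansion_power_polynomial n :
  arc_expansion n (power_polynomial r a) =
  \sum_j (r j)%:MP%:P * (\sum_(k < n) ('X_(mxvec_index k j))%:P * 'X^k) ^+ a j.
Proof.
pose h : {rmorphism F -> {poly {mpoly F[n * m]}}} := polyC \o @mpolyC (n * m) F.
pose E : {mpoly F[m]} -> {poly {mpoly F[n * m]}} := mmap h
  (fun j => \sum_(k < n) ('X_(mxvec_index k j))%:P * 'X^k).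
rewrite -[LHS]/(E _).
transitivity (\sum_j E (r j *: 'X_j ^+ a j)); first exact: raddf_sum.
apply: eq_bigr => j _; transitivity (h (r j) * E ('X_j ^+ a j)); first exact: mmapZ.
have -> : E ('X_j ^+ a j) = E 'X_j ^+ a j by exact: rmorphXn.
by rewrite /E mmapX mmap1U.
Qed.

Lemma map_arc_expansion (R : Art) n (x : 'rV[R]_(n * m)) :
  map_poly (mmap (in_alg R) (x 0)) (arc_expansion n (power_polynomial r a)) =
  power_sum (arc_poly (@cell_pos n) (fun v => x 0 (mxvec_index v.1 v.2))) :> {poly R}.
Proof.
rewrite arc_expansion_power_polynomial raddf_sum /power_sum.
apply: eq_bigr => j _ /=; rewrite rmorphM rmorphXn /= map_polyC /= mmapC mul_polyC.
congr (_ *: _ ^+ _).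
rewrite rmorph_sum /= /arc_poly.
rewrite (eq_bigl (fun v : cell n => predT v.1 && (v.2 == j))) //.
rewrite -(pair_big_dep predT (fun _ i => i == j)
  (fun k i => x 0 (mxvec_index k i) *: 'X^k)) /=.
apply: eq_bigr => i _; rewrite big_pred1_eq rmorphM /= map_polyC /= map_polyXn.
by rewrite mmapX mmap1U mul_polyC.
Qed.

Lemma value_arc_expansion (R : Art) n (x : 'rV[R]_(n * m)) k :
  value x (arc_expansion n (power_polynomial r a))`_k =
  (power_sum (arc_poly (@cell_pos n) (fun v => x 0 (mxvec_index v.1 v.2))))`_k.
Proof. by rewrite -map_arc_expansion coef_map. Qed.

Lemma Igusa_stratum n :
  Igusa_geom [:: power_polynomial r a] n = set_class (@stratum n 0).
Proof.
apply/esym/(@set_classE _ _ (formulary1 (schemic_formula (linear_arcs n [:: power_polynomial r a])))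
  _ (fun v : cell n => mxvec_index v.1 v.2)); split.
  by have [g gK Kg] := curry_mxvec_bij n m; exists g => [[k j]|i];
    [exact: (gK (k, j) isT)|have := Kg i isT; case: (g i)].
move=> R x; rewrite defset1 sat_schemic; split=> [H|[H _] f].
  split=> // t; rewrite -value_arc_expansion; apply: H.
  by apply/allpairsP; exists (power_polynomial r a, val t); rewrite mem_head mem_iota /= ltn_ord.
case/allpairsP=> -[g k] /= [/[!inE] /eqP -> kn ->]; rewrite value_arc_expansion.
by move: kn; rewrite mem_iota => /andP[_ kn]; apply: (H (Ordinal kn)).
Qed.
End Arcs.

(** * Coordinates on the stratum of weight T *)

Section Coordinates.
Variables (m : nat) (a : 'I_m -> nat).
Hypothesis a_gt0 : forall i, (0 < a i)%N.
Variables (A T k : nat) (i : 'I_m).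
Hypothesis (Tk : T = (k * a i)%N) (TA : (T < A)%N).

(** On the arcs of stratum T whose coefficient of degree k in coordinate i is a unit, the
    n - T - 1 equations of degree strictly between T and n will be solved for the
    n - T - 1 coefficients of degree strictly between k and n - T + k in coordinate i,
    while the coefficients of weight less than T are 0.  The other coefficients are undetermined. *)
Definition undetermined n (v : cell m n) : bool :=
  (T <= v.1 * a v.2)%N && ((v.2 == i) ==> (v.1 <= k)%N || (n - T + k <= v.1)%N).

Definition core_cell := {v : cell m A | undetermined v}.

Definition core_pos (q : core_cell) : nat * 'I_m := cell_pos (val q).

Lemma core_pos_inj : injective core_pos.
Proof. by move=> q q' /cell_pos_inj/val_inj. Qed.

(** The undetermined coefficients for n = N + A, in terms of those for n = A.  In a
    coordinate other than i there are N new ones, in degrees at least A.  In coordinate i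
    the solved range has N more degrees, so the undetermined coefficients beyond it move
    up by N. *)
Definition embed_pos N (w : core_cell + 'I_N * 'I_m.-1) : nat * 'I_m :=
  match w with
  | inl q => (if ((val q).2 == i) && (k < (val q).1)%N then ((val q).1 + N)%N
              else (val q).1 : nat, (val q).2)
  | inr u => ((A + u.1)%N, fintype.lift i u.2)
  end.

Lemma embed_pos_lt N (w : core_cell + 'I_N * 'I_m.-1) : ((embed_pos w).1 < N + A)%N.
Proof.
clear Tk TA a_gt0.
case: w => [[[l j] /= _]|[l j]] /=; last by have := ltn_ord l; lia.
by case: ifP => _; have := ltn_ord l; lia.
Qed.

Definition embed N (w : core_cell + 'I_N * 'I_m.-1) : cell m (N + A) :=
  (Ordinal (embed_pos_lt w), (embed_pos w).2).

Let kT j : (T <= j * a i)%N = (k <= j)%N.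
Proof. by rewrite Tk leq_pmul2r. Qed.

Let kleT : (k <= T)%N.
Proof. by rewrite Tk leq_pmulr. Qed.

Lemma embed_undetermined N w : undetermined (@embed N w).
Proof.
rewrite /undetermined /embed; case: w => [[[l j] /= /andP[/= H1 /= H2]]|[l j]] /=.
  case: eqP H2 => [ji|_] /=; last by rewrite H1.
  subst j; move: H1; rewrite !kT => kl /orP H; case: ltnP => lk; lia.
rewrite eq_sym (negbTE (neq_lift _ _)) /= andbT.
by apply: leq_trans (leq_pmulr _ (a_gt0 _)); lia.
Qed.

Lemma embed_onto N (v : cell m (N + A)) : undetermined v -> exists w, @embed N w = v.
Proof.
case: v => l j /andP[/= H1 /= H2].
have eqv w : embed_pos w = (l : nat, j) -> @embed N w = (l, j).
  move=> E; apply: (@cell_pos_inj m (N + A)).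
  by rewrite -[RHS]E /cell_pos /=; case: (embed_pos w).
have lNA := ltn_ord l.
have [ji|ji] := eqVneq j i; last first.
  have [lA|Al] := ltnP l A.
    have H : undetermined ((Ordinal lA, j) : cell m A).
      by rewrite /undetermined /= H1 (negbTE ji).
    exists (inl (exist _ (Ordinal lA, _) H : core_cell)); apply: eqv => /=.
    by rewrite (negbTE ji).
  have lN : (l - A < N)%N by lia.
  case: (unlift_some (_ : i != j)) => [|j' jE _]; first by rewrite eq_sym.
  exists (inr (Ordinal lN, j')); apply: eqv => /=; rewrite -jE.
  by rewrite subnKC.
subst j; move: H1 H2; rewrite kT eqxx /= => kl /orP[lk|lk].
  have lA : (l < A)%N by lia.
  have H : undetermined ((Ordinal lA, i) : cell m A).
    by rewrite /undetermined /= kT kl lk /= implybT.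
  exists (inl (exist _ (Ordinal lA, _) H : core_cell)); apply: eqv => /=.
  by rewrite ltnNge lk andbF.
have lA : (l - N < A)%N by lia.
have H : undetermined ((Ordinal lA, i) : cell m A).
  rewrite /undetermined /= kT eqxx /=; apply/andP; split; first by lia.
  by apply/orP; right; lia.
exists (inl (exist _ (Ordinal lA, _) H : core_cell)); apply: eqv => /=.
by rewrite eqxx (_ : k < l - N)%N; [rewrite subnK //|]; lia.
Qed.

Lemma embed_inj N : injective (@embed N).
Proof.
move=> w w' /(congr1 (@cell_pos m (N + A))) E.
have {E} : embed_pos w = embed_pos w'.
  by move: E; rewrite /cell_pos /=; case: (embed_pos w); case: (embed_pos w').
case: w w' => [[[l j] q]|[l j]] [[[l' j'] q']|[l' j']] /= [E1 E2].
- subst j'; suff E : l = l' by subst l'; congr (inl _); apply: val_inj.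
  have lA := ltn_ord l; have lA' := ltn_ord l'; apply: ord_inj.
  case/andP: q => /= _ q; case/andP: q' => /= _ q'; move: q q'.
  move: E1; case: (j == i) => //= E1 q q'.
  move: E1; case: ltnP => H1; case: ltnP => H2; lia.
- subst j; move: E1; rewrite eq_sym (negbTE (neq_lift _ _)) /= => E1.
  by have := ltn_ord l; rewrite E1; lia.
- subst j'; move: E1; rewrite eq_sym (negbTE (neq_lift _ _)) /= => E1.
  by have := ltn_ord l'; rewrite -E1; lia.
- by congr (inr (_, _)); apply: ord_inj; [lia|exact: can_inj (bumpK i) _ _ E2].
Qed.

(* A core cell in position of degree exactly T stays in place. *)
Lemma embed_pivot N (q : core_cell) :
  ((val q).1 * a (val q).2)%N = T -> cell_pos (@embed N (inl q)) = core_pos q.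
Proof.
case: q => [[l j] q] /= E; rewrite /cell_pos /core_pos /= /cell_pos /=.
case: (eqVneq j i) => [ji|] //=; subst j; congr (_, _).
by move/eqP: E; rewrite Tk eqn_pmul2r // => /eqP ->; rewrite ltnn.
Qed.

Lemma core_pivot (j : 'I_m) : (a j %| T)%N ->
  exists q : core_cell, core_pos q = ((T %/ a j)%N, j).
Proof.
move=> ajT; have lA : (T %/ a j < A)%N by apply: leq_ltn_trans (leq_div _ _) TA.
have H : undetermined ((Ordinal lA, j) : cell m A).
  rewrite /undetermined /= divnK // leqnn /=; case: eqP => //= ji; subst j.
  by rewrite {1}Tk mulnK // leqnn.
by exists (exist _ (Ordinal lA, j) H).
Qed.
End Coordinates.

(** * Strata *)

Section Strata.
Variables (F : fieldType) (m : nat) (r : 'I_m -> F) (a : 'I_m -> nat).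
Hypothesis a_gt0 : forall i, (0 < a i)%N.
Hypothesis r_neq0 : forall i, r i != 0.
Local Notation Art := (artinian_local_algebra F).
Local Notation stratum := (stratum r a).
Local Notation power_sum := (power_sum r a).

(** What remains of stratum T when the arcs with a unit of weight T in a coordinate of l
    have been removed. *)
Definition peeled n T (l : seq 'I_m) : pointset F (cell m n) := fun R x =>
  stratum T x /\
  forall v : cell m n, (v.1 * a v.2 == T)%N && (v.2 \in l) -> x v \isn't a GRing.unit.

Definition leading n T (l : seq 'I_m) (i : 'I_m) : pointset F (cell m n) := fun R x =>
  peeled T l x /\
  forall v : cell m n, (v.1 * a v.2 == T)%N && (v.2 == i) -> x v \is a GRing.unit.

Lemma formula_def_peeled n T l : formula_def (@peeled n T l).
Proof.
apply: formula_def_and; first exact/schemic_formula_def/schemic_def_stratum.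
apply: formula_def_forall => v; apply: formula_def_if.
have [phi H] := formula_def_not (formula_def_unit F v).
by exists phi => R x; rewrite H; split=> /negP.
Qed.

Lemma formula_def_leading n T l i : formula_def (@leading n T l i).
Proof.
apply: formula_def_and; first exact: formula_def_peeled.
apply: formula_def_forall => v; apply: formula_def_if; exact: formula_def_unit.
Qed.

Lemma scalar_unit (R : Art) (c : F) : c != 0 -> (c%:A : R) \is a GRing.unit.
Proof. by move=> c0; rewrite scaler_unit ?unitr1 ?unitfE. Qed.

Section Core.
Variables (A T k : nat) (i : 'I_m) (l : seq 'I_m).
Hypothesis (Tk : T = (k * a i)%N) (TA : (T < A)%N) (ai : (a i)%:R != 0 :> F).
Local Notation core_cell := (core_cell a A T k i).
Local Notation core_pos := (@core_pos m a A T k i).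
Local Notation embed := (@embed m a A T k i).

(** The conditions that bear on undetermined coefficients only: the equation of degree T
    and the conditions on the coefficients of weight T.  They do not depend on N. *)
Definition core : pointset F core_cell := fun R y =>
  (power_sum (arc_poly core_pos y))`_T = 0 /\
  ((forall q : core_cell, ((core_pos q).1 * a (core_pos q).2 == T)%N && ((core_pos q).2 \in l) ->
      y q \isn't a GRing.unit) /\
   (forall q : core_cell, ((core_pos q).1 * a (core_pos q).2 == T)%N && ((core_pos q).2 == i) ->
      y q \is a GRing.unit)).

Lemma formula_def_core : formula_def core.
Proof.
apply: formula_def_and; first exact/schemic_formula_def/schemic_def_eq0/polyfun_power_sum.
apply: formula_def_and; apply: formula_def_forall => q; apply: formula_def_if.
  have [phi H] := formula_def_not (formula_def_unit F q).
  by exists phi => R x; rewrite H; split=> /negP.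
exact: formula_def_unit.
Qed.

Lemma core_coef0 (R : Art) (y : core_cell -> R) j d :
  (d * a j < T)%N -> (arc_poly core_pos y j)`_d = 0.
Proof.
move=> dT; apply: arc_coef0 => -[v vu] [vd vj]; have /andP[Tv _] := vu.
by move: dT Tv; rewrite -vd -vj /=; lia.
Qed.

(** The equation of degree T involves only coefficients of weight T, and these are
    undetermined. *)
Lemma core_equation N (R : Art) (x : cell m (N + A) -> R) :
  (forall v : cell m (N + A), (v.1 * a v.2 < T)%N -> x v = 0) ->
  (power_sum (arc_poly core_pos (x \o @embed N \o inl)))`_T =
  (power_sum (arc_poly (@cell_pos m (N + A)) x))`_T.
Proof.
move=> xT.
have [|_ ->] := @power_sum_low F m r a a_gt0 R
    (arc_poly core_pos (x \o @embed N \o inl)) T.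
  by move=> j d; apply: core_coef0.
have [|_ ->] := @power_sum_low F m r a a_gt0 R (arc_poly (@cell_pos m (N + A)) x) T.
  by move=> j d; apply: stratum_coef.
apply: eq_bigr => j jT; congr (_ * _ ^+ _).
have [q qE] := core_pivot a_gt0 Tk TA jT.
rewrite (arc_coef _ (@core_pos_inj _ _ _ _ _ _) qE) /=; apply/esym.
apply: arc_coef; first exact: cell_pos_inj.
have vE : ((val q).1 * a (val q).2)%N = T.
  by move: qE; rewrite /core_pos /cell_pos => -[-> ->]; rewrite divnK.
by rewrite (embed_pivot a_gt0 Tk N vE).
Qed.

Lemma embed_core_cond N (P : bool -> Prop) (p : pred 'I_m) (Q : cell m (N + A) -> bool) :
  (forall v : cell m (N + A), (v.1 * a v.2 == T)%N && p v.2 -> P (Q v)) <->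
  (forall q : core_cell, ((core_pos q).1 * a (core_pos q).2 == T)%N && p (core_pos q).2 ->
    P (Q (@embed N (inl q)))).
Proof.
split=> H [v].
  move=> vq /andP[/eqP E pv]; apply: H.
  have wv := embed_pivot a_gt0 Tk N (q := exist _ v vq) E.
  have wv1 : (@embed N (inl (exist _ v vq))).1 = v.1 :> nat := congr1 fst wv.
  have wv2 : (@embed N (inl (exist _ v vq))).2 = v.2 := congr1 snd wv.
  by rewrite wv1 wv2; apply/andP; split=> //; apply/eqP.
move=> j /= /andP[/eqP E pj].
have jT : (a j %| T)%N by rewrite -E dvdn_mull.
have [q qE] := core_pivot a_gt0 Tk TA jT.
have vE : ((val q).1 * a (val q).2)%N = T.
  by move: qE; rewrite /core_pos /cell_pos => -[-> ->]; rewrite divnK.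
have -> : (v, j) = @embed N (inl q).
  apply: (@cell_pos_inj m (N + A)); rewrite (embed_pivot a_gt0 Tk N vE) qE /cell_pos /=.
  by rewrite -E mulnK.
by apply: H; rewrite qE /= pj divnK // eqxx.
Qed.

(** The coefficients left out by embed are determined by the others: with u the arc in
    coordinate i divided by 'X^k, the equation of degree T + l reads r_i (u ^+ a_i)`_l = ...,
    where the right-hand side involves the other coordinates only. *)
Lemma leading_exists N (R : Art) (y : core_cell + 'I_N * 'I_m.-1 -> R) :
  core (y \o inl) -> exists2 x, @leading (N + A) T l i R x & x \o @embed N = y.
Proof.
move=> [yT [yl yi]].
(* x0 has the prescribed undetermined coefficients and 0 in the other places. *)
pose x0 (v : cell m (N + A)) := if [pick w | @embed N w == v] is Some w then y w else 0.
have x0E w : x0 (@embed N w) = y w.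
  rewrite /x0; case: pickP => [w' /eqP/(embed_inj a_gt0 Tk TA) -> //|/(_ w)].
  by rewrite eqxx.
have x0N (v : cell m (N + A)) : ~~ undetermined a T k i v -> x0 v = 0.
  rewrite /x0; case: pickP => [w /eqP <-|//].
  by rewrite (embed_undetermined a_gt0 Tk TA).
have x0T (v : cell m (N + A)) : (v.1 * a v.2 < T)%N -> x0 v = 0.
  by move=> vT; apply: x0N; rewrite /undetermined leqNgt vT.
have kT : (k <= T)%N by rewrite Tk leq_pmulr.
have kA : (k < N + A)%N by lia.
pose P0 := arc_poly (@cell_pos m (N + A)) x0.
have aT : (a i %| T)%N by rewrite Tk dvdn_mull.
have [q0 q0E] := core_pivot a_gt0 Tk TA aT.
have kE : (T %/ a i)%N = k by rewrite Tk mulnK.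
have q0T : ((val q0).1 * a (val q0).2)%N = T.
  by move: q0E; rewrite /core_pos /cell_pos => -[-> ->]; rewrite kE.
have P0k : (P0 i)`_k = y (inl q0).
  rewrite -x0E; apply: arc_coef; first exact: cell_pos_inj.
  by rewrite (embed_pivot a_gt0 Tk N q0T) q0E kE.
have P0ku : (P0 i)`_k \is a GRing.unit.
  by rewrite P0k; apply: yi; rewrite q0E /= kE -Tk !eqxx.
(* the value of (u ^+ a_i)`_s that makes the equation of degree T + s hold *)
pose b s := - (r i)%:A^-1 * (\sum_(j | j != i) (r j)%:A *: P0 j ^+ a j)`_(T + s) : R.
have aU : ((a i)%:R : R) \is a GRing.unit by rewrite -scaler_nat scalar_unit.
have [|u [u0 uge ub]] := @exp_root_exists R (drop_poly k (P0 i)) (a i) (N + A - T) b _ aU.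
  by rewrite coef_drop_poly.
rewrite coef_drop_poly add0n in u0.
pose x (v : cell m (N + A)) :=
  if (v.2 == i) && (k <= v.1)%N then u`_(v.1 - k) else x0 v.
have xy : x \o @embed N = y.
  apply/funext=> w; have := embed_undetermined a_gt0 Tk TA w.
  rewrite -x0E -[LHS]/(x (@embed N w)); move: (@embed N w) => v.
  rewrite /x; case: ifP => // /andP[/eqP wi kw] /andP[_]; rewrite wi eqxx /= => H.
  have P0v : (P0 i)`_v.1 = x0 v by rewrite -[in LHS]wi cell_coef.
  have [vk|vk] := leqP v.1 k.
    have vkE : v.1 = k :> nat by lia.
    by rewrite -P0v vkE subnn u0.
  by rewrite uge ?coef_drop_poly ?subnK //; lia.
have xT (v : cell m (N + A)) : (v.1 * a v.2 < T)%N -> x v = 0.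
  move=> vT; rewrite /x; case: ifP => [/andP[/eqP vi kv]|_]; last exact: x0T.
  by move: vT; rewrite vi Tk ltn_pmul2r // ltnNge kv.
have arcj j : j != i -> arc_poly (@cell_pos m (N + A)) x j = P0 j.
  move=> ji; apply/polyP=> d; have [dN|Nd] := ltnP d (N + A); last by rewrite !cell_coef_ge.
  have := cell_coef x (Ordinal dN, j); have := cell_coef x0 (Ordinal dN, j).
  by rewrite /P0 /= => -> ->; rewrite /x /= (negbTE ji).
have arci : arc_poly (@cell_pos m (N + A)) x i = u * 'X^k.
  apply/polyP=> d; rewrite coefMXn; have [dN|Nd] := ltnP d (N + A); last first.
    rewrite cell_coef_ge //; case: ltnP => // kd.
    by rewrite uge ?coef_drop_poly ?subnK ?cell_coef_ge //; lia.
  have := cell_coef x (Ordinal dN, i) => /= ->; rewrite /x /= eqxx /=.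
  by case: ltnP => //= dk; apply: x0T; rewrite /= Tk ltn_pmul2r.
exists x => //; split; first split; first split=> [t|//].
- have [low _] := power_sum_low r a_gt0 (fun j d => @stratum_coef F m a (N + A) T R x j d xT).
  case: (ltngtP t T) => [/low //|Tt|tT]; last first.
    by rewrite tT -core_equation // -[RHS]yT -xy.
  rewrite /power_sum (bigD1 i) //= arci exprMn -exprM -Tk.
  rewrite (eq_bigr (fun j => (r j)%:A *: P0 j ^+ a j)); last by move=> j /arcj ->.
  have tN := ltn_ord t; rewrite coefD coefZ coefMXn ltnNge (ltnW Tt) /=.
  rewrite ub; last by lia.
  rewrite /b subnKC; last exact: ltnW.
  by rewrite mulrA mulrN mulrV ?scalar_unit // mulN1r addNr.
- apply/(@embed_core_cond N (fun b => ~~ b) (mem l) (fun v => x v \is a GRing.unit)).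
  by move=> q H; have := yl q H; rewrite -xy.
- apply/(@embed_core_cond N (fun b => b) (pred1 i) (fun v => x v \is a GRing.unit)).
  by move=> q H; have := yi q H; rewrite -xy.
Qed.

Lemma leading_unique N (R : Art) (x x' : cell m (N + A) -> R) :
  stratum T x -> leading T l i x' -> x \o @embed N = x' \o @embed N -> x = x'.
Proof.
move=> [xE xT] [[[xE' xT'] _] xi'] xx'.
have und (v : cell m (N + A)) : undetermined a T k i v -> x v = x' v.
  by move=> /(embed_onto a_gt0 Tk TA)[w <-]; apply: (congr1 (@^~ w) xx').
have kT : (k <= T)%N by rewrite Tk leq_pmulr.
have kN : (k < N + A)%N by lia.
have arcj j : j != i -> arc_poly (@cell_pos m (N + A)) x j = arc_poly (@cell_pos m (N + A)) x' j.
  move=> ji; apply/polyP=> d; have [dN|Nd] := ltnP d (N + A); last by rewrite !cell_coef_ge.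
  have := cell_coef x (Ordinal dN, j); have := cell_coef x' (Ordinal dN, j) => /= -> ->.
  have [lt|ge] := ltnP (d * a j) T; first by rewrite xT ?xT'.
  by apply: und; rewrite /undetermined /= ge (negbTE ji).
pose u (z : cell m (N + A) -> R) := drop_poly k (arc_poly (@cell_pos m (N + A)) z i).
have uT (z : cell m (N + A) -> R) : (forall v : cell m (N + A), (v.1 * a v.2 < T)%N -> z v = 0) ->
    arc_poly (@cell_pos m (N + A)) z i ^+ a i = u z ^+ a i * 'X^T.
  move=> zT; rewrite (@coef_exp_low _ _ k) ?Tk // => d dk.
  by apply: stratum_coef zT _; rewrite Tk ltn_pmul2r.
have ucoef z (v : cell m (N + A)) : v.2 = i -> (k <= v.1)%N -> (u z)`_(v.1 - k) = z v.
  by move=> vi kv; rewrite coef_drop_poly subnK // -vi cell_coef.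
pose v0 : cell m (N + A) := (Ordinal kN, i).
have v0u : undetermined a T k i v0 by rewrite /undetermined /= -Tk leqnn leqnn implybT.
have u0 z : (u z)`_0 = z v0 by have := ucoef z v0; rewrite /= subnn; apply.
have aU : ((a i)%:R : R) \is a GRing.unit by rewrite -scaler_nat scalar_unit.
have uu d : (d < N + A - T)%N -> (u x)`_d = (u x')`_d.
  apply: (@exp_root_unique R _ _ (a i)) => //.
  - by rewrite !u0 und.
  - by rewrite u0 und //; apply: xi'; rewrite /= -Tk !eqxx.
  move=> {}d /andP[d0 dM]; have tN : (T + d < N + A)%N by lia.
  have eqt (z : cell m (N + A) -> R) :
      (forall v : cell m (N + A), (v.1 * a v.2 < T)%N -> z v = 0) ->
      (power_sum (arc_poly (@cell_pos m (N + A)) z))`_(T + d) = 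
      (r i)%:A * (u z ^+ a i)`_d +
        (\sum_(j | j != i) (r j)%:A *: arc_poly (@cell_pos m (N + A)) z j ^+ a j)`_(T + d).
    move=> zT; rewrite /power_sum (bigD1 i) //= uT // coefD coefZ coefMXn.
    by rewrite ltnNge leq_addr /= addKn.
  have /= := etrans (xE (Ordinal tN)) (esym (xE' (Ordinal tN))).
  rewrite (eqt x) // (eqt x') //.
  under eq_bigr => j ji do rewrite arcj //.
  by move/addIr; apply: mulrI; apply: scalar_unit.
apply/funext=> v; have [/und //|] := boolP (undetermined a T k i v).
rewrite /undetermined negb_and -ltnNge negb_imply => /orP[vT|]; first by rewrite xT ?xT'.
case/andP=> /eqP vi; rewrite negb_or -!ltnNge => /andP[kv vN].
by rewrite -(ucoef x v) ?(ltnW kv) // -(ucoef x' v) ?(ltnW kv) // uu //; lia.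
Qed.

(** The N * m.-1 new undetermined coefficients are not subject to any condition. *)
Lemma set_class_leading N :
  set_class (@leading (N + A) T l i) = set_class core * (Lefschetz F ^+ m.-1) ^+ N.
Proof.
rewrite -exprM -[(_ * N)%N](_ : #|{: 'I_N * 'I_m.-1}| = _); last first.
  by rewrite card_prod !card_ord mulnC.
rewrite -set_class_affine -set_class_prod; last 2 first.
- exact: formula_def_core.
- exact: formula_def_True.
apply: (@set_class_iso _ _ _ _ _ _ (@embed N) _ _ (@schemic_def_stratum F m r a (N + A) T)).
- exact: formula_def_leading.
- apply: formula_def_and; first exact: formula_def_preim formula_def_core.
  exact: formula_def_True.
- move=> R x [[xS xl] xi]; split=> //; split=> //; case: xS => xE xT.
  split; first by rewrite core_equation //; apply: (xE (Ordinal _)); lia.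
  split.
    exact/(@embed_core_cond N (fun b => ~~ b) (mem l) (fun v => x v \is a GRing.unit)).
  exact/(@embed_core_cond N (fun b => b) (pred1 i) (fun v => x v \is a GRing.unit)).
- by move=> R y [/leading_exists].
- exact: leading_unique.
Qed.
End Core.
End Strata.

(** * The recurrence *)

Section Recurrence.
Variables (F : fieldType) (m : nat) (r : 'I_m -> F) (a : 'I_m -> nat).
Hypothesis a_gt0 : forall i, (0 < a i)%N.
Hypothesis r_neq0 : forall i, r i != 0.
Hypothesis a_tame : forall i j, (a i)%:R = 0 :> F -> (a j)%:R = 0 :> F -> i = j.
Local Notation Art := (artinian_local_algebra F).
Local Notation stratum := (stratum r a).
Local Notation peeled := (peeled r a).
Local Notation power_sum := (power_sum r a).
Local Notation lambda := (Lefschetz F ^+ m.-1).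

Lemma set_class_peel A T i l : (a i %| T)%N -> (T < A)%N -> (a i)%:R != 0 :> F ->
  exists c : Grform F, forall N, set_class (@peeled (N + A) T l) =
    set_class (@peeled (N + A) T (i :: l)) + (c * lambda ^+ N - empty_class F).
Proof.
move=> /dvdnP[k Tk] TA ai.
exists (set_class (core r l : pointset F (core_cell a A T k i))) => N.
have kA : (k < N + A)%N by have := leq_pmulr k (a_gt0 i); lia.
pose v0 : cell m (N + A) := (Ordinal kA, i).
pose B : pointset F (cell m (N + A)) := fun R x =>
  forall v : cell m (N + A), (v.1 * a v.2 == T)%N && (v.2 == i) -> x v \is a GRing.unit.
have FB : formula_def B.
  by apply: formula_def_forall => v; apply/formula_def_if/formula_def_unit.
have v0P (v : cell m (N + A)) : (v.1 * a v.2 == T)%N && (v.2 == i) -> v = v0.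
  case: v => d j /= /andP[/eqP dj /eqP ji]; subst j; congr (_, _); apply: ord_inj => /=.
  by move/eqP: dj; rewrite Tk eqn_pmul2r // => /eqP.
have v0T : (v0.1 * a v0.2 == T)%N by rewrite /= Tk.
rewrite (set_class_split (formula_def_peeled _ _ _ _ _) FB); congr (_ + (_ - _)).
  congr set_class; apply: pointsetP => R x; split=> [[[xS xl] nB]|[xS xl]].
    split=> // v; rewrite inE andb_orr => /orP[|/xl //] vi.
    by apply/negP => u; apply: nB => v' /v0P ->; rewrite -(v0P _ vi).
  split; first split=> // v /andP[vT vl]; first by apply: xl; rewrite vT inE vl orbT.
  move/(_ v0); rewrite v0T /= eqxx => /(_ isT); apply/negP/xl.
  by rewrite v0T /= mem_head.
rewrite -set_class_leading //; by congr set_class.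
Qed.

Lemma nonunit_sum (R : Art) (I : finType) (P : pred I) (f : I -> R) :
  (forall i, P i -> f i \isn't a GRing.unit) -> \sum_(i | P i) f i \isn't a GRing.unit.
Proof.
move=> H; apply: (big_ind (fun z : R => z \isn't a GRing.unit)) => //.
  by rewrite unitr0.
exact: art_local.
Qed.

(** The equation of degree T expresses r_i x_i ^+ a_i, for the only exponent that may
    vanish in F, as a combination of powers of the other coefficients of weight T.  Sums
    of nonunits being nonunits, the coefficient x_i is a nonunit if the others are. *)
Lemma all_nonunit n T (R : Art) (x : cell m n -> R) : (T < n)%N -> stratum T x ->
  (forall v : cell m n, (v.1 * a v.2 == T)%N -> (a v.2)%:R != 0 :> F ->
     x v \isn't a GRing.unit) ->
  forall v : cell m n, (v.1 * a v.2 == T)%N -> x v \isn't a GRing.unit.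
Proof.
move=> Tn [xE xT] H [d i] vT.
have [ai|ai] := eqVneq ((a i)%:R : F) 0; last exact: H vT ai.
have [_ sumE] := power_sum_low r a_gt0 (fun j d => @stratum_coef F m a n T R x j d xT).
have := xE (Ordinal Tn); rewrite /= sumE.
have coefE (e : 'I_n) j : (e * a j == T)%N ->
    (arc_poly (@cell_pos m n) x j)`_(T %/ a j) = x (e, j).
  by move=> /eqP <-; rewrite mulnK // -(cell_coef x (e, j)).
have iT : (a i %| T)%N by rewrite -(eqP vT) dvdn_mull.
rewrite (bigD1 i) //= (coefE d) // => /eqP; rewrite addr_eq0 => /eqP xiE.
apply/negP => u.
have : (r i)%:A * x (d, i) ^+ a i \is a GRing.unit.
  by rewrite unitrM unitrX // scalar_unit.
rewrite xiE unitrN; apply/negP/nonunit_sum => j /andP[jT ji].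
have eT : (T %/ a j < n)%N by apply: leq_ltn_trans (leq_div _ _) Tn.
rewrite (coefE (Ordinal eT)) /= ?divnK // unitrM negb_and; apply/orP; right.
rewrite unitrX_pos //; apply: H; rewrite /= ?divnK //.
by apply/eqP => aj; move/eqP: ji; apply; apply: a_tame.
Qed.

(** Stratum T + 1 is obtained by setting the coefficients of weight T to 0, which has the
    same effect on classes as asking them to be nonunits. *)
Lemma set_class_stratumS n T : 
  set_class (@stratum n T.+1) = set_class (fun R (x : cell m n -> R) =>
    stratum T x /\ forall v : cell m n, (v.1 * a v.2 == T)%N -> x v \isn't a GRing.unit).
Proof.
pose s := [seq v : cell m n <- enum {: cell m n} | (v.1 * a v.2 == T)%N].
have sE (v : cell m n) : (v \in s) = (v.1 * a v.2 == T)%N by rewrite mem_filter mem_enum andbT.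
transitivity (set_class (fun R (x : cell m n -> R) =>
    stratum T x /\ forall v, v \in s -> x v = 0)).
  congr set_class; apply: pointsetP => R x; split=> [[xE xT]|[[xE xT] xs]].
    split; first by split=> // v vT; apply: xT; apply: ltnW.
    by move=> v; rewrite sE => /eqP vT; apply: xT; rewrite vT.
  split=> // v; rewrite ltnS leq_eqVlt => /orP[vT|/xT //].
  by apply: xs; rewrite sE.
rewrite -set_class_jet; last exact: schemic_def_stratum.
congr set_class; apply: pointsetP => R x; split=> -[xS H]; split=> // v.
  by rewrite -sE; apply: H.
by rewrite sE; apply: H.
Qed.

(** Here N is n - A, so that all weights T < A are less than n. *)
Definition geometric (h : nat -> Grform F) : Prop :=
  exists c0 c, forall N, h N = c0 + c * lambda ^+ N.

Lemma geometricD f g : geometric f -> geometric g -> geometric (fun N => f N + g N).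
Proof.
move=> [c0 [c H]] [d0 [d H']]; exists (c0 + d0), (c + d) => N.
by rewrite H H' mulrDl addrACA.
Qed.

Lemma geometric0 : geometric (fun=> 0).
Proof. by exists 0, 0 => N; rewrite mul0r addr0. Qed.

Lemma set_class_stratum_step A T : (T < A)%N -> exists2 h, geometric h &
  forall N, set_class (@stratum (N + A) T) = set_class (@stratum (N + A) T.+1) + h N.
Proof.
move=> TA; pose good j := (a j %| T)%N && ((a j)%:R != 0 :> F).
have peel l : all good l -> exists2 h, geometric h &
    forall N, set_class (@stratum (N + A) T) = set_class (@peeled (N + A) T l) + h N.
  elim: l => [|i l IH] /=.
    exists (fun=> 0); first exact: geometric0.
    move=> N; rewrite addr0; congr set_class; apply: pointsetP => R x.
    by split=> [xS|[]//]; split=> // v; rewrite in_nil andbF.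
  case/andP=> /andP[iT ai] /IH[h Gh Hh]; have [c Hc] := set_class_peel l iT TA ai.
  exists (fun N => (c * lambda ^+ N - empty_class F) + h N).
    by apply: geometricD => //; exists (- empty_class F), c => N; rewrite addrC.
  by move=> N; rewrite Hh Hc -!addrA.
have [|h Gh Hh] := peel (enum good); first by apply/allP => j; rewrite mem_enum.
exists h => // N; rewrite Hh set_class_stratumS; congr (set_class _ + _).
have TN : (T < N + A)%N by lia.
apply: pointsetP => R x; split=> [[xS H]|[xS H]]; split=> // v; last first.
  by case/andP=> vT _; apply: H.
apply: (all_nonunit TN xS) => {}v vT av; apply: H; rewrite vT /= mem_enum.
by rewrite unfold_in /good -(eqP vT) dvdn_mull.
Qed.

Lemma set_class_stratum_steps A T : (T <= A)%N -> exists2 h, geometric h &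
  forall N, set_class (@stratum (N + A) 0) = set_class (@stratum (N + A) T) + h N.
Proof.
elim: T => [|T IH] TA.
  by exists (fun=> 0); [exact: geometric0|move=> N; rewrite addr0].
have [h Gh Hh] := IH (ltnW TA); have [h' Gh' Hh'] := set_class_stratum_step TA.
exists (fun N => h' N + h N); first exact: geometricD.
by move=> N; rewrite Hh Hh' addrA.
Qed.

Section Period.
Variable A : nat.
Hypothesis A_dvd : forall j, (a j %| A)%N.

Let d j := (A %/ a j)%N.

Let dA j : (d j * a j)%N = A. Proof. exact: divnK. Qed.

Let ltd e j : (e * a j < A)%N = (e < d j)%N.
Proof. by rewrite -{1}(dA j) ltn_pmul2r. Qed.

Let dleA j : (d j <= A)%N. Proof. exact: leq_div. Qed.

(** On stratum A, dividing x_j by 'X^(A/a_j) leaves N + A - A/a_j coefficients.  The first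
    N of them are those of an arc modulo 'X^N; the A - A/a_j others do not occur in the
    equations.  The latter are indexed independently of N by their degree minus N. *)
Definition tail_cell := {v : cell m A | (A <= v.1 * a v.2)%N}.

Definition shift_pos N (w : cell m N + tail_cell) : nat * 'I_m :=
  match w with
  | inl v => ((v.1 + A %/ a v.2)%N, v.2)
  | inr q => (((val q).1 + N)%N, (val q).2)
  end.

Lemma shift_pos_lt N (w : cell m N + tail_cell) : ((shift_pos w).1 < N + A)%N.
Proof.
case: w => [[e j]|[[e j] q]] /=; last by have := ltn_ord e; lia.
by have := ltn_ord e; have := dleA j; rewrite /d; lia.
Qed.

Definition shift N (w : cell m N + tail_cell) : cell m (N + A) :=
  (Ordinal (shift_pos_lt w), (shift_pos w).2).

Lemma shift_eq N w (v : cell m (N + A)) : shift_pos w = cell_pos v -> @shift N w = v.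
Proof.
move=> E; apply: (@cell_pos_inj m (N + A)); rewrite -E /cell_pos /=.
by case: (shift_pos w).
Qed.

Lemma shift_onto N (v : cell m (N + A)) : (A <= v.1 * a v.2)%N -> exists w, @shift N w = v.
Proof.
case: v => e j /= eA; have de : (d j <= e)%N by rewrite leqNgt -ltd -leqNgt.
have eNA := ltn_ord e; have := dleA j => dj.
have [eN|Ne] := ltnP (e - d j) N.
  by exists (inl (Ordinal eN, j)); apply: shift_eq; rewrite /cell_pos /= subnK.
have eA' : (e - N < A)%N by lia.
have H : (A <= ((Ordinal eA', j) : cell m A).1 * a j)%N.
  by rewrite leqNgt ltd -leqNgt /=; lia.
exists (inr (exist _ (Ordinal eA', j) H : tail_cell)); apply: shift_eq.
by rewrite /cell_pos /= subnK //; lia.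
Qed.

Lemma shift_inj N : injective (@shift N).
Proof.
move=> w w' /(congr1 (@cell_pos m (N + A))) E.
have {E} : shift_pos w = shift_pos w'.
  by move: E; rewrite /cell_pos /=; case: (shift_pos w); case: (shift_pos w').
case: w w' => [[e j]|[[e j] q]] [[e' j']|[[e' j'] q']] /= [E1 E2]; subst j'.
- by congr (inl (_, _)); apply: ord_inj; lia.
- by have := q'; rewrite /= leqNgt ltd -leqNgt /d; have := ltn_ord e; lia.
- by have := q; rewrite /= leqNgt ltd -leqNgt /d; have := ltn_ord e'; lia.
- suff E : e = e' by subst e'; congr (inr _); apply: val_inj.
  by apply: ord_inj; lia.
Qed.

Lemma shift_tall N w : (A <= (@shift N w).1 * a (shift w).2)%N.
Proof.
rewrite leqNgt; case: w => [[e j]|[[e j] q]] /=.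
  by rewrite ltd /d -leqNgt leq_addl.
by rewrite -leqNgt; apply: leq_trans q _; rewrite leq_mul2r leq_addr orbT.
Qed.

Lemma shift_equation N (R : Art) (x : cell m (N + A) -> R) t :
  (forall v : cell m (N + A), (v.1 * a v.2 < A)%N -> x v = 0) -> (t < N)%N ->
  (power_sum (arc_poly (@cell_pos m (N + A)) x))`_(t + A) =
  (power_sum (arc_poly (@cell_pos m N) (x \o @shift N \o inl)))`_t.
Proof.
move=> xA tN; rewrite /power_sum !coef_sum; apply: eq_bigr => j _; rewrite !coefZ.
congr (_ * _); rewrite (@coef_exp_low _ _ (d j)); last first.
  by move=> e ed; apply: stratum_coef xA _; rewrite ltd.
rewrite dA coefMXn ltnNge leq_addl addnK; apply: coef_exp_eq => e et.
have eN : (e < N)%N by apply: leq_ltn_trans et tN.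
rewrite coef_drop_poly; have := cell_coef (x \o @shift N \o inl) (Ordinal eN, j) => /= ->.
apply: arc_coef; first exact: cell_pos_inj.
by rewrite /cell_pos /=.
Qed.

Lemma set_class_period N : set_class (@stratum (N + A) A) =
  set_class (@stratum N 0) * Lefschetz F ^+ #|{: tail_cell}|.
Proof.
rewrite -set_class_affine -set_class_prod; last 2 first.
- exact/schemic_formula_def/schemic_def_stratum.
- exact: formula_def_True.
apply: (@set_class_iso _ _ _ _ _ _ (@shift N) _ _ (@schemic_def_stratum F m r a (N + A) A)).
- exact/schemic_formula_def/schemic_def_stratum.
- apply: formula_def_and; last exact: formula_def_True.
  exact/formula_def_preim/schemic_formula_def/schemic_def_stratum.
- move=> R x [xE xA]; split=> //; split=> //; split=> // t.
  rewrite -shift_equation //; have tA : (t + A < N + A)%N by rewrite ltn_add2r.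
  exact: (xE (Ordinal tA)).
- move=> R y [[yE _] _].
  pose x (v : cell m (N + A)) := if [pick w | @shift N w == v] is Some w then y w else 0.
  have xy : x \o @shift N = y.
    apply/funext=> w; rewrite -[LHS]/(x (shift w)) /x.
    case: pickP => [w' /eqP/shift_inj -> //|/(_ w)].
    by rewrite eqxx.
  have xA (v : cell m (N + A)) : (v.1 * a v.2 < A)%N -> x v = 0.
    rewrite /x; case: pickP => [w /eqP <-|//].
    by rewrite ltnNge shift_tall.
  exists x => //; split=> // t.
  have [low _] := power_sum_low r a_gt0 (fun j e => @stratum_coef F m a (N + A) A R x j e xA).
  have [/low //|At] := ltnP t A.
  have tN : (t - A < N)%N by have := ltn_ord t; lia.
  rewrite -(subnK At) shift_equation // xy.
  exact: (yE (Ordinal tN)).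
- move=> R x x' [_ xA] [_ xA'] xx'; apply/funext=> v.
  have [vA|/shift_onto[w <-]] := ltnP (v.1 * a v.2) A; first by rewrite xA ?xA'.
  exact: (congr1 (@^~ w) xx').
Qed.
End Period.

Lemma Igusa_recurrence : exists A s c0 c, (0 < A)%N /\ forall n,
  Igusa_geom [:: power_polynomial r a] (n + A)%N =
  Lefschetz F ^+ s * Igusa_geom [:: power_polynomial r a] n + (c0 + c * lambda ^+ n).
Proof.
(* Any common multiple of the exponents would do. *)
pose A := (\prod_i a i)%N.
have A_dvd j : (a j %| A)%N by rewrite /A (bigD1 j) //= dvdn_mulr.
have A0 : (0 < A)%N by apply: prodn_gt0.
have [h [c0 [c Hc]] Hh] := set_class_stratum_steps (leqnn A).
exists A, #|{: tail_cell A}|, c0, c; split=> // n.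
by rewrite !Igusa_stratum Hh set_class_period // Hc mulrC.
Qed.
End Recurrence.

(** * Isolated singularities *)

Section Isolated.
Variables (F : closedFieldType) (m : nat).

(** The polynomial g that isolates the origin restricts to a polynomial on the curve gam
    which is nonzero at 0, hence at some s != 0 since F is infinite. *)
Lemma isolated_curve (f : {mpoly F[m]}) (gam : 'I_m -> {poly F}) :
  isolated_singularity f 0 -> (forall i, (gam i).[0] = 0) ->
  (forall s, singular_point f (\row_i (gam i).[s])) ->
  exists2 s, s != 0 & forall i, (gam i).[s] = 0.
Proof.
move=> [_ [g g0 gP]] gam0 gamS.
pose G := mmap polyC gam g.
have GE s : G.[s] = g.@[(\row_i (gam i).[s]) 0].
  rewrite /G /meval /mmap horner_sum; apply: eq_bigr => e _.
  rewrite hornerM hornerC; congr (_ * _); rewrite /mmap1 horner_prod.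
  by apply: eq_bigr => i _; rewrite horner_exp mxE.
have G0 : G != 0.
  apply: contraNneq g0 => G0; have := GE 0; rewrite G0 horner0.
  have -> : \row_i (gam i).[0] = 0 by apply/rowP=> i; rewrite !mxE gam0.
  by move=> /esym/eqP.
have : G * 'X != 0 by rewrite mulf_neq0 ?polyX_eq0.
case/closed_nonrootP=> s; rewrite rootM negb_or => /andP[Gs s0].
exists s; first by move: s0; rewrite rootE hornerX.
have /rowP E : \row_i (gam i).[s] = 0 by apply: gP => //; rewrite -GE.
by move=> i; have := E i; rewrite !mxE.
Qed.

Variables (r : 'I_m -> F) (a : 'I_m -> nat).
Hypothesis a_gt0 : forall i, (0 < a i)%N.

Lemma mderiv_exp (p : {mpoly F[m]}) n i : (p ^+ n)^`M(i) = (p ^+ n.-1 * p^`M(i)) *+ n.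
Proof.
elim: n => [|n IH]; first by rewrite expr0 mulr0n -mpolyC1 mderivC.
rewrite exprS mderivM IH /= mulrS mulrC; congr (_ + _).
case: n {IH} => [|n]; first by rewrite !mulr0n mulr0.
by rewrite mulrnAr mulrA -exprS.
Qed.

Lemma singular_pointE (x : 'rV[F]_m) : singular_point (power_polynomial r a) x <->
  \sum_i r i * x 0 i ^+ a i = 0 /\ forall i, r i * (x 0 i ^+ (a i).-1 *+ a i) = 0.
Proof.
have -> : \sum_i r i * x 0 i ^+ a i = (power_polynomial r a).@[x 0].
  rewrite /power_polynomial raddf_sum; apply: eq_bigr => i _ /=.
  by rewrite mevalZ rmorphXn /= mevalXU.
suff H i : ((power_polynomial r a)^`M(i)).@[x 0] = r i * (x 0 i ^+ (a i).-1 *+ a i).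
  by split=> -[? E]; split=> // i; have := E i; rewrite H.
transitivity (\sum_j ((r j *: 'X_j ^+ a j)^`M(i)).@[x 0]).
  by rewrite -(raddf_sum (meval (x 0))); congr meval; apply: raddf_sum.
have termE j : ((r j *: 'X_j ^+ a j)^`M(i)).@[x 0] =
    r j * ((x 0 j ^+ (a j).-1 * (i == j)%:R) *+ a j).
  rewrite mderivZ mevalZ mderiv_exp; congr (_ * _); rewrite mevalMn; congr (_ *+ _).
  rewrite mevalM; congr (_ * _); first by rewrite rmorphXn /= mevalXU.
  rewrite mderivX mevalZ mnm1E eq_sym; case: eqP => [->|_]; last by rewrite mul0r.
  have -> : (U_(j) - U_(j) = 0)%MM by apply/mnmP=> l; rewrite mnmBE mnm0E subnn.
  by rewrite mpolyX0 [X in _ * X](rmorph1 (meval _)) mulr1.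
rewrite (bigD1 i) //= termE eqxx mulr1 big1 ?addr0 // => j ji.
by rewrite termE eq_sym (negbTE ji) mulr0 mul0rn mulr0.
Qed.

(** If r_i = 0 the i-th coordinate axis is singular.  If a_i and a_j vanish in F for some
    i != j, so does the gradient of f along the curve r_i x_i ^+ a_i + r_j x_j ^+ a_j = 0 of
    the (i, j) coordinate plane, which is parametrized by x_i = s ^+ a_j and
    x_j = b s ^+ a_i. *)
Lemma isolated_power_sum : isolated_singularity (power_polynomial r a) 0 ->
  (forall i, r i != 0) /\
  (forall i j, (a i)%:R = 0 :> F -> (a j)%:R = 0 :> F -> i = j).
Proof.
move=> iso; have [/singular_pointE[_ der0] _] := iso.
have exp0 j : (0 : F) ^+ a j = 0 by rewrite expr0n; case: (a j) (a_gt0 j).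
have r0 i : r i != 0.
  apply/eqP => ri; pose gam j : {poly F} := if j == i then 'X else 0.
  have [j||s s0 /(_ i)] := @isolated_curve (power_polynomial r a) gam iso.
  - by rewrite /gam; case: ifP => _; rewrite ?hornerX ?horner0.
  - move=> s; apply/singular_pointE; split=> [|j].
      apply: big1 => j _; rewrite mxE /gam; case: eqP => [->|_]; first by rewrite ri mul0r.
      by rewrite horner0 exp0 mulr0.
    rewrite mxE /gam; case: eqP => [->|_]; first by rewrite ri mul0r.
    by rewrite horner0; have := der0 j; rewrite mxE.
  by rewrite /gam eqxx hornerX => s00; rewrite s00 eqxx in s0.
split=> // i j ai aj; apply/eqP/negPn/negP => ij.
have /closed_rootP[b] : size ('X^(a j) + (r i / r j)%:P) != 1%N.
  by rewrite size_XnaddC // eqSS -lt0n.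
rewrite rootE hornerD hornerXn hornerC => /eqP bE.
pose gam l : {poly F} :=
  if l == i then 'X^(a j) else if l == j then b *: 'X^(a i) else 0.
have [l||s s0 /(_ i)] := @isolated_curve (power_polynomial r a) gam iso.
- rewrite /gam; case: ifP => _; first by rewrite hornerXn exp0.
  by case: ifP => _; rewrite ?hornerZ ?hornerXn ?exp0 ?mulr0 ?horner0.
- move=> s; apply/singular_pointE; split=> [|l].
    rewrite (bigD1 i) //= (bigD1 j) /=; last by rewrite eq_sym.
    rewrite big1 ?addr0 => [|l /andP[/negbTE li /negbTE lj]]; last first.
      by rewrite mxE /gam li lj horner0 exp0 mulr0.
    rewrite !mxE /gam eqxx eq_sym (negbTE ij) eqxx hornerZ !hornerXn exprMn.
    rewrite -!exprM [(a i * a j)%N]mulnC mulrA -mulrDl.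
    have -> : b ^+ a j = - (r i / r j) by apply/eqP; rewrite -addr_eq0 bE.
    by rewrite mulrN [r j * _]mulrC divfK // subrr mul0r.
  rewrite mxE /gam; case: eqP => [->|_]; first by rewrite -mulr_natr ai !mulr0.
  case: eqP => [->|_]; first by rewrite -mulr_natr aj !mulr0.
  by rewrite horner0; have := der0 l; rewrite mxE.
by rewrite /gam eqxx hornerXn; apply/eqP; rewrite expf_neq0.
Qed.
End Isolated.

Theorem theorem9p13 (F : closedFieldType) (m : nat) (r : 'I_m -> F)
    (a : 'I_m -> nat) :
  (forall i, (0 < a i)%N) ->
  power_polynomial r a != 0 ->
  isolated_singularity (power_polynomial r a) 0 ->
  ps_rational
    (fun n => loc_map (Lefschetz F) (Igusa_geom [:: power_polynomial r a] n)).
Proof.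
move=> a_gt0 _ /(isolated_power_sum a_gt0)[r_neq0 a_tame].
have [A [s [c0 [c [A0 rec]]]]] := Igusa_recurrence a_gt0 r_neq0 a_tame.
pose phi := loc_map (Lefschetz F).
apply: (ps_rational_recurrence A0 (mu := phi (Lefschetz F ^+ s))
  (h := fun n => phi c0 + phi c * phi (Lefschetz F ^+ m.-1) ^+ n)).
  by move=> n; rewrite rec rmorphD rmorphM rmorphD rmorphM (rmorphXn _ n).
exact: (ps_rational_geometric (phi c0) (phi c) (phi (Lefschetz F ^+ m.-1))).
Qed.
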